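(* Let $\mathcal{D}_{\mathbb{X}}$ be a Calabi-Yau-$\mathbb{X}$ category such that $K(\mathcal{D}_{\mathbb{X}})$ is free of finite rank $n$ over $R=\mathbb{Z}[q^{\pm1}]$. Let $\widehat\sigma=(\widehat Z,\widehat{\mathcal{P}})$ be a stability condition on an $\mathbb{X}$-baric heart $\mathcal{D}_\infty$ of $\mathcal{D}_{\mathbb{X}}$ and let $s\in\mathbb{C}$. Let $\sigma_\oplus=(Z,\mathcal{P}_\oplus)$ and $\sigma_*=(Z,\mathcal{P}_* )$ be the additive and extension data induced from $(\mathcal{D}_\infty,\widehat\sigma,s)$. Then: (1) $\sigma_\oplus$ is a stability condition on $\mathcal{D}_{\mathbb{X}}$ if and only if $\operatorname{Hom}(\widehat{\mathcal{P}}(\phi_1),\widehat{\mathcal{P}}(\phi_2))=0$ for all $\phi_1,\phi_2\in\mathbb{R}$ with $\phi_2-\phi_1\ge\operatorname{Re}(s)-1$. (2) $\sigma_*$ is a stability condition on $\mathcal{D}_{\mathbb{X}}$ if and only if $\operatorname{gldim}\widehat\sigma\le\operatorname{Re}(s)-1$. Moreover, when they are stability conditions, $(\sigma_\oplus,s)$ and $(\sigma_*,s)$ are $q$-stability conditions, and they satisfy the $q$-support property with lattice $\Gamma=K(\mathcal{D}_\infty)$.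
   Context: All categories are linear over an algebraically closed field $\mathbf{k}$. A stability condition $\sigma=(Z,\mathcal{P})$ on a triangulated category $\mathcal{D}$ consists of a group homomorphism $Z\colon K(\mathcal{D})\to\mathbb{C}$ and full additive subcategories $\mathcal{P}(\phi)\subset\mathcal{D}$, $\phi\in\mathbb{R}$ (slicing), such that (a) if $0\ne E\in\mathcal{P}(\phi)$ then $Z(E)=m(E)e^{\mathbf{i}\pi\phi}$ with $m(E)>0$; (b) $\mathcal{P}(\phi+1)=\mathcal{P}(\phi)[1]$; (c) $\operatorname{Hom}(\mathcal{P}(\phi_1),\mathcal{P}(\phi_2))=0$ for $\phi_1>\phi_2$; (d) every $0\neq E$ has a Harder-Narasimhan filtration: a finite chain $0=E_0\to E_1\to\cdots\to E_m=E$ with successive cones $A_i\in\mathcal{P}(\phi_i)$, $\phi_1>\dots>\phi_m$. Nonzero objects of $\mathcal{P}(\phi)$ are semistable, simple objects of $\mathcal{P}(\phi)$ are stable; $\mathrm{ss}(\sigma)$ is the set of classes in $K(\mathcal{D})$ of semistable objects. On categories with $K(\mathcal{D})$ of finite rank, stability conditions (such as $\widehat\sigma$ on $\mathcal{D}_\infty$) are assumed to satisfy the support property: for a norm on $K(\mathcal{D})\otimes\mathbb{R}$ there is $C>0$ with $C|Z(\alpha)|>\|\alpha\|$ for all $\alpha\in\mathrm{ss}(\sigma)$. The global dimension of $\sigma=(Z,\mathcal P)$ is $\operatorname{gldim}\sigma=\sup\{\phi_2-\phi_1\mid\operatorname{Hom}(\mathcal{P}(\phi_1),\mathcal{P}(\phi_2))\ne0\}$.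 $\mathcal{D}_{\mathbb{X}}$ is a triangulated category with a distinguished auto-equivalence $\mathbb{X}$; $E[l\mathbb{X}]:=\mathbb{X}^l(E)$; $R$ acts on $K(\mathcal{D}_{\mathbb{X}})$ by $q^l[E]=[E[l\mathbb{X}]]$. It is Calabi-Yau-$\mathbb{X}$ if there are natural isomorphisms $\operatorname{Hom}(X,Y)\cong\operatorname{Hom}(Y,X[\mathbb{X}])^\vee$. An $\mathbb{X}$-baric heart is a full triangulated subcategory $\mathcal{D}_\infty\subset\mathcal{D}_{\mathbb{X}}$ such that $\operatorname{Hom}(A_1,A_2)=0$ for $A_i\in\mathcal{D}_\infty[k_i\mathbb{X}]$, $k_1>k_2$, and every nonzero $E\in\mathcal{D}_{\mathbb{X}}$ has a finite filtration by triangles with successive cones $A_i\in\mathcal{D}_\infty[k_i\mathbb{X}]$, $k_1>\dots>k_m$. Then $K(\mathcal{D}_\infty)\otimes_{\mathbb{Z}}R\cong K(\mathcal{D}_{\mathbb{X}})$. Induced data: $Z\colon K(\mathcal{D}_{\mathbb{X}})\to\mathbb{C}$ is $\widehat Z\otimes1\colon K(\mathcal{D}_\infty)\otimes R\to\mathbb{C}[q^{\pm1}]$ followed by $q\mapsto e^{\mathbf{i}\pi s}$; $\mathcal{P}_\oplus(\phi)=\operatorname{add}\bigoplus_{k\in\mathbb{Z}}\widehat{\mathcal{P}}(\phi-k\operatorname{Re}(s))[k\mathbb{X}]$; $\mathcal{P}_*(\phi)=\langle\widehat{\mathcal{P}}(\phi-k\operatorname{Re}(s))[k\mathbb{X}]\mid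 k\in\mathbb{Z}\rangle$, the extension-closed full subcategory generated by these. A $q$-stability condition $(\sigma,s)$ is a stability condition $\sigma=(Z,\mathcal{P})$ on $\mathcal{D}_{\mathbb{X}}$ and $s\in\mathbb{C}$ with $\mathcal{P}(\phi+\operatorname{Re}(s))=\mathcal{P}(\phi)[\mathbb{X}]$ for all $\phi$ and $Z(q\alpha)=e^{\mathbf{i}\pi s}Z(\alpha)$ for all $\alpha$. It satisfies the $q$-support property with lattice $\Gamma\cong\mathbb{Z}^n\subset K(\mathcal{D}_{\mathbb{X}})$, $\Gamma\otimes_{\mathbb{Z}}R\cong K(\mathcal{D}_{\mathbb{X}})$, if there is a subset $\widehat{\mathrm{ss}}(\sigma)\subset\{\sum_{j=0}^lq^j\alpha_j\mid\alpha_j\in\Gamma\}$ such that (1) $\mathrm{ss}(\sigma)=\bigcup_{k\in\mathbb{Z}}q^k\cdot\widehat{\mathrm{ss}}(\sigma)$; (2) for some norm on $\Gamma\otimes\mathbb{R}$ there is $C>0$ with $C|Z(\alpha)|>\|\alpha\|$ for all $\alpha\in\widehat{\mathrm{ss}}(\sigma)$, where $\|\sum_jq^j\alpha_j\|:=\sum_j|e^{\mathbf{i}\pi js}|\|\alpha_j\|$; (3) for any semistable $E$ with $[E]\in\Gamma$ there is $N_0$ such that for any stable $F$ with $[F]\in\Gamma$, $\operatorname{Hom}(E,F[k\mathbb{X}])=0=\operatorname{Hom}(F,E[k\mathbb{X}])$ when $|k|>N_0$. *)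

(* Defs.v *)
From HB Require Import structures.
From mathcomp Require Import all_boot all_order all_algebra finmap generic_quotient.
From mathcomp Require Import all_classical all_reals all_analysis complex.
From mathcomp Require Import freeg.

Set Implicit Arguments.
Unset Strict Implicit.
Unset Printing Implicit Defensive.

Import Order.TTheory GRing.Theory Num.Theory.

Local Open Scope ring_scope.
Local Open Scope classical_set_scope.
Local Open Scope quotient_scope.

Declare Scope cat_scope.
Delimit Scope cat_scope with cat.
Local Open Scope cat_scope.

Record linCategory (k : fieldType) := LinCategory {
  obj :> Type;
  hom : obj -> obj -> lmodType k;
  idm : forall X, hom X X;
  comp : forall X Y Z, hom Y Z -> hom X Y -> hom X Z;
  comp_idl : forall X Y (f : hom X Y), comp (idm Y) f = f;
  comp_idr : forall X Y (f : hom X Y), comp f (idm X) = f;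
  comp_assoc : forall X Y Z W (h : hom Z W) (g : hom Y Z) (f : hom X Y),
    comp h (comp g f) = comp (comp h g) f;
  comp_linl : forall X Y Z (f : hom X Y) a (g g' : hom Y Z),
    comp (a *: g + g') f = a *: comp g f + comp g' f;
  comp_linr : forall X Y Z (g : hom Y Z) a (f f' : hom X Y),
    comp g (a *: f + f') = a *: comp g f + comp g f'
}.

Arguments hom {k l} X Y : rename.
Arguments idm {k l} X : rename.
Arguments comp {k l X Y Z} g f : rename.

Notation "g ∘ f" := (comp g f) (at level 40, left associativity) : cat_scope.

Section LinearCategories.
Variable k : fieldType.
Implicit Types C D B : linCategory k.

Definition is_iso C (X Y : C) (f : hom X Y) : Prop :=
  exists g : hom Y X, g ∘ f = idm X /\ f ∘ g = idm Y.

Definition iso C (X Y : C) : Prop := exists f : hom X Y, is_iso f.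

Definition is_zero C (X : C) : Prop := idm X = 0.

Definition is_dsum C (X Y S : C) : Prop :=
  exists (i : hom X S) (j : hom Y S) (p : hom S X) (q : hom S Y),
    [/\ p ∘ i = idm X, q ∘ j = idm Y, q ∘ i = 0, p ∘ j = 0
      & i ∘ p + j ∘ q = idm S].

Record functor C D := Functor {
  fobj :> C -> D;
  fmap : forall X Y : C, hom X Y -> hom (fobj X) (fobj Y);
  fmap_id : forall X : C, fmap (idm X) = idm (fobj X);
  fmap_comp : forall (X Y Z : C) (g : hom Y Z) (f : hom X Y),
    fmap (g ∘ f) = fmap g ∘ fmap f;
  fmap_lin : forall (X Y : C) a (f f' : hom X Y),
    fmap (a *: f + f') = a *: fmap f + fmap f'
}.

Definition idF C : functor C C.
Proof. by exists (fun X => X) (fun X Y f => f). Defined.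

Definition compF C D B (G : functor D B) (F : functor C D) : functor C B.
Proof.
exists (fun X => G (F X)) (fun X Y f => fmap G (fmap F f)).
- by move=> X; rewrite !fmap_id.
- by move=> X Y Z g f; rewrite !fmap_comp.
- by move=> X Y a f f'; rewrite !fmap_lin.
Defined.

Definition natural C D (F G : functor C D)
    (eta : forall X, hom (F X) (G X)) : Prop :=
  forall (X Y : C) (f : hom X Y), eta Y ∘ fmap F f = fmap G f ∘ eta X.

Definition nat_iso C D (F G : functor C D) : Prop :=
  exists eta : forall X, hom (F X) (G X),
    natural eta /\ forall X, is_iso (eta X).

Record autoequiv C := Autoequiv {
  fwd :> functor C C;
  bwd : functor C C;
  bwdK : nat_iso (compF bwd fwd) (idF C);
  fwdK : nat_iso (compF fwd bwd) (idF C)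
}.

End LinearCategories.

Section TriangulatedAxioms.
Variables (k : fieldType) (C : linCategory k) (T : autoequiv C).
Variable dist : forall X Y Z : C, hom X Y -> hom Y Z -> hom Z (T X) -> Prop.

Record triangulated_axioms : Prop := TriangulatedAxioms {
  tr_zero : exists Z : C, is_zero Z;
  tr_dsum : forall X Y : C, exists S : C, is_dsum X Y S;
  tr1_iso : forall (X Y Z X' Y' Z' : C)
      (f : hom X Y) (g : hom Y Z) (h : hom Z (T X))
      (f' : hom X' Y') (g' : hom Y' Z') (h' : hom Z' (T X'))
      (a : hom X X') (b : hom Y Y') (c : hom Z Z'),
    is_iso a -> is_iso b -> is_iso c ->
    b ∘ f = f' ∘ a -> c ∘ g = g' ∘ b -> fmap T a ∘ h = h' ∘ c ->
    dist f g h -> dist f' g' h';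
  tr1_id : forall X Z : C, is_zero Z ->
    dist (idm X) (0 : hom X Z) (0 : hom Z (T X));
  tr1_cone : forall (X Y : C) (f : hom X Y),
    exists (Z : C) (g : hom Y Z) (h : hom Z (T X)), dist f g h;
  tr2 : forall (X Y Z : C) (f : hom X Y) (g : hom Y Z) (h : hom Z (T X)),
    dist f g h <-> dist g h (- fmap T f);
  tr3 : forall (X Y Z X' Y' Z' : C)
      (f : hom X Y) (g : hom Y Z) (h : hom Z (T X))
      (f' : hom X' Y') (g' : hom Y' Z') (h' : hom Z' (T X'))
      (a : hom X X') (b : hom Y Y'),
    dist f g h -> dist f' g' h' -> b ∘ f = f' ∘ a ->
    exists c : hom Z Z', c ∘ g = g' ∘ b /\ fmap T a ∘ h = h' ∘ c;
  tr4 : forall (X Y Z A B E : C) (f : hom X Y) (g : hom Y Z)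
      (i : hom Y A) (i' : hom A (T X)) (j : hom Z B) (j' : hom B (T Y))
      (l : hom Z E) (l' : hom E (T X)),
    dist f i i' -> dist g j j' -> dist (g ∘ f) l l' ->
    exists (u : hom A E) (v : hom E B),
      [/\ dist u v (fmap T i ∘ j'), u ∘ i = l ∘ g, l' ∘ u = i',
          v ∘ l = j & j' ∘ v = fmap T f ∘ l']
}.

End TriangulatedAxioms.

Record triCategory (k : fieldType) := TriCategory {
  tri_cat :> linCategory k;
  shift : autoequiv tri_cat;
  dist : forall X Y Z : tri_cat, hom X Y -> hom Y Z -> hom Z (shift X) -> Prop;
  triP : triangulated_axioms dist
}.

Arguments shift {k} t : rename.
Arguments dist {k t X Y Z} f g h : rename.

Section Triangulated.
Variable k : fieldType.
Implicit Types D : triCategory k.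

Definition exact_functor D (F : functor D D) : Prop :=
  exists theta : forall X : D, hom (F (shift D X)) (shift D (F X)),
    [/\ @natural k D D (compF F (shift D)) (compF (shift D) F) theta,
        forall X, is_iso (theta X)
      & forall (X Y Z : D) (f : hom X Y) (g : hom Y Z) (h : hom Z (shift D X)),
          dist f g h -> dist (fmap F f) (fmap F g) (theta X ∘ fmap F h)].

Definition is_ext D (A E B : D) : Prop :=
  exists (f : hom A E) (g : hom E B) (h : hom B (shift D A)), dist f g h.

Definition hom_vanish D (P Q : set D) : Prop :=
  forall (X Y : D) (f : hom X Y), P X -> Q Y -> f = 0.

Definition additive_sub D (P : set D) : Prop :=
  [/\ forall X Y : D, iso X Y -> P X -> P Y,
      exists2 Z : D, is_zero Z & P Z
    & forall X Y S : D, is_dsum X Y S -> P X -> P Y -> P S].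

(** [E] is the end of a chain 0 = E_0 -> E_1 -> ... -> E_m = E whose i-th cone
    lies in [P (nth i t)]. *)
Inductive filtered D I (P : I -> set D) : seq I -> D -> Prop :=
| Filtered0 E : is_zero E -> filtered P [::] E
| FilteredS t i E' E A : filtered P t E' -> is_ext E' E A -> P i A ->
    filtered P (rcons t i) E.

Inductive add_closure D (P : set D) : D -> Prop :=
| Add_gen E : P E -> add_closure P E
| Add_zero E : is_zero E -> add_closure P E
| Add_sum A B E : is_dsum A B E -> add_closure P A -> add_closure P B ->
    add_closure P E
| Add_summand A B E : is_dsum A B E -> add_closure P E -> add_closure P A.

Inductive ext_closure D (P : set D) : D -> Prop :=
| Ext_gen E : P E -> ext_closure P E
| Ext_zero E : is_zero E -> ext_closure P E
| Ext_ext A B E : is_ext A E B -> ext_closure P A -> ext_closure P B ->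
    ext_closure P E.

Record triangulated_sub D (T : set D) : Prop := TriangulatedSub {
  sub_add : additive_sub T;
  sub_shift : forall X : D, T X <-> T (shift D X);
  sub_cone : forall X Y Z : D, is_ext X Y Z -> T X -> T Y -> T Z
}.

End Triangulated.

Section FullSub.
Variables (k : fieldType) (D : triCategory k) (T : set D).
Hypothesis hT : triangulated_sub T.

Let S := {X : D | T X}.

Definition sub_lin : linCategory k.
Proof.
exists S (fun X Y => hom (sval X) (sval Y)) (fun X => idm (sval X))
  (fun X Y Z g f => g ∘ f).
- by move=> X Y f; exact: comp_idl.
- by move=> X Y f; exact: comp_idr.
- by move=> *; exact: comp_assoc.
- by move=> *; exact: comp_linl.
- by move=> *; exact: comp_linr.
Defined.

Definition restrF (F : functor D D) (hF : forall X, T X -> T (F X)) :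
  functor sub_lin sub_lin.
Proof.
exists (fun X : sub_lin => exist _ (F (sval X)) (hF _ (svalP X)) : sub_lin)
  (fun X Y f => fmap F f).
- by move=> X; exact: fmap_id.
- by move=> *; exact: fmap_comp.
- by move=> *; exact: fmap_lin.
Defined.

Lemma sub_shift_fwd X : T X -> T (fwd (shift D) X).
Proof. by move=> /(sub_shift hT). Qed.

Lemma sub_shift_bwd X : T X -> T (bwd (shift D) X).
Proof.
move=> TX; apply/(sub_shift hT); case: (hT) => -[isoT _ _] _ _.
have [eta [_ /(_ X) [g [gK Kg]]]] := fwdK (shift D).
by apply: (isoT X) TX; exists g; exists (eta X).
Qed.

Definition sub_shiftF : autoequiv sub_lin.
Proof.
exists (restrF sub_shift_fwd) (restrF sub_shift_bwd).
- have [eta [nat_eta iso_eta]] := bwdK (shift D).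
  exists (fun X : sub_lin => eta (sval X)); split=> [X Y f|X].
    exact: nat_eta.
  exact: iso_eta.
- have [eta [nat_eta iso_eta]] := fwdK (shift D).
  exists (fun X : sub_lin => eta (sval X)); split=> [X Y f|X].
    exact: nat_eta.
  exact: iso_eta.
Defined.

Definition sub_dist (X Y Z : sub_lin) (f : hom X Y) (g : hom Y Z)
    (h : hom Z (sub_shiftF X)) : Prop :=
  @dist k D (sval X) (sval Y) (sval Z) f g h.

Lemma sub_triP : triangulated_axioms sub_dist.
Proof.
case: (hT) => -[isoT [Z0 Z0z TZ0] sumT] shT coneT; split.
- by exists (exist _ Z0 TZ0 : sub_lin).
- move=> X Y; have [E hE] := tr_dsum (triP D) (sval X) (sval Y).
  by exists (exist _ E (sumT _ _ _ hE (svalP X) (svalP Y)) : sub_lin).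
- by move=> X Y Z X' Y' Z' f g h f' g' h' a b c; exact: (tr1_iso (triP D)).
- by move=> X Z; exact: (tr1_id (triP D)).
- move=> X Y f; have [Z [g [h fgh]]] := tr1_cone (triP D) f.
  have TZ : T Z by apply: coneT (svalP X) (svalP Y); exists f, g, h.
  by exists (exist _ Z TZ : sub_lin), g, h.
- by move=> X Y Z f g h; exact: (tr2 (triP D)).
- by move=> X Y Z X' Y' Z' f g h f' g' h' a b; exact: (tr3 (triP D)).
- by move=> X Y Z A B E f g i i' j j' l l'; exact: (tr4 (triP D)).
Qed.

Definition sub_tri : triCategory k := TriCategory sub_triP.

End FullSub.

Section QuotientGroup.
Variables (V : zmodType) (S : set V).

Inductive gen_subgroup : V -> Prop :=
| Gen0 : gen_subgroup 0
| GenI x : S x -> gen_subgroup x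
| GenB x y : gen_subgroup x -> gen_subgroup y -> gen_subgroup (x - y).

Definition congr_mod (x y : V) : bool := `[< gen_subgroup (x - y) >].

Lemma genN x : gen_subgroup x -> gen_subgroup (- x).
Proof. by move=> gx; rewrite -sub0r; apply: GenB gx; exact: Gen0. Qed.

Lemma genD x y : gen_subgroup x -> gen_subgroup y -> gen_subgroup (x + y).
Proof. by move=> gx gy; rewrite -[y]opprK; apply: GenB => //; exact: genN. Qed.

Lemma congr_mod_refl : reflexive congr_mod.
Proof. by move=> x; apply/asboolP; rewrite subrr; exact: Gen0. Qed.

Lemma congr_mod_sym : symmetric congr_mod.
Proof.
by move=> x y; apply/asboolP/asboolP => /genN; rewrite opprB.
Qed.

Lemma congr_mod_trans : transitive congr_mod.
Proof.
move=> y x z /asboolP xy /asboolP yz; apply/asboolP.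
by have := genD xy yz; rewrite addrA subrK.
Qed.

Canonical congr_mod_equiv :=
  EquivRel congr_mod congr_mod_refl congr_mod_sym congr_mod_trans.

Definition quot_group : Type := {eq_quot congr_mod}.
HB.instance Definition _ := Choice.on quot_group.
HB.instance Definition _ := EqQuotient.on quot_group.

Definition quot_pi (x : V) : quot_group := \pi x.

Lemma quot_piP x y : quot_pi x = quot_pi y <-> gen_subgroup (x - y).
Proof. by split=> [/eqmodP/asboolP//|xy]; apply/eqmodP/asboolP. Qed.

Definition quot_add (x y : quot_group) := quot_pi (repr x + repr y).
Definition quot_opp (x : quot_group) := quot_pi (- repr x).

Lemma quot_reprK (x : quot_group) : quot_pi (repr x) = x.
Proof. exact: reprK. Qed.

Lemma repr_piP x : gen_subgroup (repr (quot_pi x) - x).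
Proof. by apply/quot_piP; rewrite quot_reprK. Qed.

Lemma quot_piD x y : quot_pi (x + y) = quot_add (quot_pi x) (quot_pi y).
Proof.
apply/esym/quot_piP; rewrite opprD addrACA.
by apply: genD; exact: repr_piP.
Qed.

Lemma quot_piN x : quot_pi (- x) = quot_opp (quot_pi x).
Proof.
by apply/esym/quot_piP; rewrite -opprD; apply: genN; exact: repr_piP.
Qed.

Lemma quot_addA : associative quot_add.
Proof.
move=> x y z; rewrite -[x]quot_reprK -[y]quot_reprK -[z]quot_reprK.
by rewrite -!quot_piD addrA.
Qed.

Lemma quot_addC : commutative quot_add.
Proof.
by move=> x y; rewrite -[x]quot_reprK -[y]quot_reprK -!quot_piD addrC.
Qed.

Lemma quot_add0 : left_id (quot_pi 0) quot_add.
Proof. by move=> x; rewrite -[x]quot_reprK -quot_piD add0r. Qed.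

Lemma quot_addN : left_inverse (quot_pi 0) quot_opp quot_add.
Proof. by move=> x; rewrite -[x]quot_reprK -quot_piN -quot_piD addNr. Qed.

HB.instance Definition _ :=
  GRing.isZmodule.Build quot_group quot_addA quot_addC quot_add0 quot_addN.

Lemma quot_pi_is_zmod_morphism : zmod_morphism quot_pi.
Proof. by move=> x y; rewrite quot_piD quot_piN. Qed.

HB.instance Definition _ :=
  GRing.isZmodMorphism.Build V quot_group quot_pi quot_pi_is_zmod_morphism.

End QuotientGroup.

Section Grothendieck.
Variables (k : fieldType) (D : triCategory k).

Definition freeOb := {freeg {classic D} / int}.

Definition triangle_rel : set freeOb :=
  [set x | exists X Y Z : D, is_ext X Y Z /\
     x = << (Y : {classic D}) >> - << (X : {classic D}) >>
         - << (Z : {classic D}) >>].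

Definition K0 : zmodType := quot_group triangle_rel.

Definition cls (X : D) : K0 := quot_pi triangle_rel << (X : {classic D}) >>.

Lemma cls_ext X Y Z : is_ext X Y Z -> cls Y = cls X + cls Z.
Proof.
move=> XYZ; rewrite /cls -raddfD; apply/quot_piP.
by apply: GenI; exists X, Y, Z; rewrite opprD addrA.
Qed.

Section Lift.
Variables (G : zmodType) (f : D -> G).

Definition additive_on_triangles :=
  forall X Y Z, is_ext X Y Z -> f Y = f X + f Z.

Definition free_lift (x : freeOb) : G := \sum_(X <- dom x) f X *~ coeff X x.

(** The homomorphism out of [K0] induced by [f], meaningful only when
    [additive_on_triangles] holds. *)
Definition K0lift (x : K0) : G := free_lift (repr x).

Lemma free_liftE (s : seq {classic D}) (x : freeOb) :
  uniq s -> {subset dom x <= s} ->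
  free_lift x = \sum_(X <- s) f X *~ coeff X x.
Proof.
move=> us sub; rewrite (bigID (mem (dom x))) /= [X in _ + X]big1 ?addr0; last first.
  by move=> X /coeff_outdom ->; rewrite mulr0z.
rewrite -big_filter; apply: perm_big; apply: uniq_perm.
- exact: uniq_dom.
- exact: filter_uniq.
by move=> X; rewrite mem_filter; case: (boolP (X \in dom x)) => // /sub ->.
Qed.

Lemma free_lift_is_zmod_morphism : zmod_morphism free_lift.
Proof.
move=> x y; pose s := undup (dom x ++ dom y).
have us : uniq s by exact: undup_uniq.
have sx : {subset dom x <= s} by move=> X Xx; rewrite mem_undup mem_cat Xx.
have sy : {subset dom y <= s} by move=> X Xy; rewrite mem_undup mem_cat Xy orbT.
have sxy : {subset dom (x - y) <= s} by move=> X /domB; rewrite mem_undup.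
rewrite (free_liftE us sx) (free_liftE us sy) (free_liftE us sxy) -sumrB.
by apply: eq_bigr => X _; rewrite raddfB /= mulrzBr.
Qed.

HB.instance Definition _ :=
  GRing.isZmodMorphism.Build freeOb G free_lift free_lift_is_zmod_morphism.

Lemma free_lift1 (X : {classic D}) : free_lift << X >> = f X.
Proof. by rewrite /free_lift domU1 big_seq1 coeffU eqxx mulr1. Qed.

Hypothesis fP : additive_on_triangles.

Lemma free_lift_rel x : gen_subgroup triangle_rel x -> free_lift x = 0.
Proof.
elim=> [|_ [X [Y [Z [XYZ ->]]]]|{}x y _ x0 _ y0]; first by rewrite raddf0.
- by rewrite !raddfB /= !free_lift1 (fP XYZ) -addrA -opprD subrr.
- by rewrite raddfB /= x0 y0 subrr.
Qed.

Lemma K0lift_pi x : K0lift (quot_pi _ x) = free_lift x.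
Proof.
apply/eqP; rewrite -subr_eq0 -raddfB /=; apply/eqP/free_lift_rel.
exact: repr_piP.
Qed.

Lemma K0lift_cls X : K0lift (cls X) = f X.
Proof. by rewrite K0lift_pi free_lift1. Qed.

Lemma K0lift_is_zmod_morphism : zmod_morphism K0lift.
Proof.
move=> x y; rewrite -[x]quot_reprK -[y]quot_reprK -raddfB /= !K0lift_pi.
by rewrite raddfB.
Qed.

End Lift.

End Grothendieck.

Arguments K0 {k} D.
Arguments cls {k D} X.
Arguments K0lift {k D G} f x.

Section Complex.
Variable R : realType.
Implicit Types (z : R[i]).

(** [exp (i pi z)] *)
Definition expipi z : R[i] :=
  ((expR (- pi * complex.Im z))%:C)%C *
  Complex (cos (pi * complex.Re z)) (sin (pi * complex.Re z)).

End Complex.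

Section Lattices.
Variable R : realType.
Implicit Types A : zmodType.

Definition int_comb A n (b : 'I_n -> A) (c : 'rV[int]_n) : A :=
  \sum_(i < n) b i *~ c 0 i.

Definition is_Zbasis A n (b : 'I_n -> A) : Prop := bijective (int_comb b).

Definition is_norm n (N : 'rV[R]_n -> R) : Prop :=
  [/\ forall x y, N (x + y) <= N x + N y,
      forall a x, N (a *: x) = `|a| * N x
    & forall x, N x = 0 -> x = 0].

(** [nrm] is the restriction to [A] of a norm on the real vector space
    spanned by a [Z]-basis of [A]. *)
Definition lattice_norm A (nrm : A -> R) : Prop :=
  exists n (b : 'I_n -> A) (N : 'rV[R]_n -> R),
    [/\ is_Zbasis b, is_norm N
      & forall c, nrm (int_comb b c) = N (map_mx intr c)].

(** [laurent A] is the tensor product of [A] with the ring of integral Laurent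
    polynomials: [u] stands for the sum of the [q^l u_l]. *)
Definition laurent A := {fsfun int -> A with 0}.

Definition laurent_sum A (B : zmodType) (act : int -> A -> B) (u : laurent A)
  : B := \sum_(l <- finsupp u) act l (u l).

End Lattices.

Section Stability.
Variables (R : realType) (k : fieldType).
Implicit Types D : triCategory k.

Definition ess_im B D (f : B -> D) (P : set B) : set D :=
  [set E | exists2 A, P A & iso (f A) E].

Record stabData D := StabData {
  charge : K0 D -> R[i];
  slice : R -> set D
}.

Section OneCategory.
Variables (D : triCategory k) (sigma : stabData D).
Let Z := charge sigma.
Let P := slice sigma.

Record is_stability : Prop := IsStability {
  stab_charge : zmod_morphism Z;
  stab_slice : forall phi, additive_sub (P phi);
  stab_phase : forall phi E, P phi E -> ~ is_zero E ->
    exists2 m : R, 0 < m & Z (cls E) = (m%:C)%C * expipi (phi%:C)%C;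
  stab_shift : forall phi, P (phi + 1) = ess_im (shift D) (P phi);
  stab_hom : forall phi1 phi2, phi2 < phi1 -> hom_vanish (P phi1) (P phi2);
  stab_HN : forall E, ~ is_zero E ->
    exists2 t : seq R, sorted >%R t & filtered P t E
}.

Definition semistable (E : D) : Prop :=
  ~ is_zero E /\ exists phi, P phi E.

Definition stable (E : D) : Prop :=
  exists phi, [/\ P phi E, ~ is_zero E
    & forall (F : D) (f : hom F E), P phi F ->
        (forall (G : D) (u : hom G F), P phi G -> f ∘ u = 0 -> u = 0) ->
        is_zero F \/ is_iso f].

Definition ss : set (K0 D) := [set cls E | E in semistable].

Definition support_property : Prop :=
  exists2 nrm : K0 D -> R, lattice_norm nrm
    & exists2 c : R, 0 < c
    & forall a, ss a -> nrm a < c * ComplexField.Normc.normc (Z a).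

Definition gldim : \bar R :=
  ereal_sup [set x | exists phi1 phi2,
    ~ hom_vanish (P phi1) (P phi2) /\ x = (phi2 - phi1)%:E].

End OneCategory.

Definition calabi_yau D (X : autoequiv D) : Prop :=
  exists eta : forall A B : D, hom A B -> {scalar hom B (X A)},
    [/\ forall A B a (f f' : hom A B) g,
          eta A B (a *: f + f') g = a * eta A B f g + eta A B f' g,
        forall A B (f : hom A B), (forall g, eta A B f g = 0) -> f = 0,
        forall A B (lam : {scalar hom B (X A)}),
          exists f, forall g, eta A B f g = lam g,
        forall A B B' (u : hom B B') (f : hom A B) (g : hom B' (X A)),
          eta A B' (u ∘ f) g = eta A B f (g ∘ u)
      & forall A A' B (v : hom A' A) (f : hom A B) (g : hom B (X A')),
          eta A' B (f ∘ v) g = eta A B f (fmap X v ∘ g)].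

Definition xpow D (X : autoequiv D) (l : int) (E : D) : D :=
  match l with
  | Posz n => iter n (fwd X) E
  | Negz n => iter n.+1 (bwd X) E
  end.

(** The action of [q ^ l]; the lift is well defined when [X] is exact. *)
Definition qact D (X : autoequiv D) (l : int) : K0 D -> K0 D :=
  K0lift (fun E => cls (xpow X l E)).

Record baric_heart D (X : autoequiv D) (T : set D) : Prop := BaricHeart {
  baric_sub : triangulated_sub T;
  baric_hom : forall l1 l2 : int, l2 < l1 ->
    hom_vanish (ess_im (xpow X l1) T) (ess_im (xpow X l2) T);
  baric_filtration : forall E : D, ~ is_zero E ->
    exists2 t : seq int, sorted >%R t
      & filtered (fun l => ess_im (xpow X l) T) t E
}.

(** Freeness of rank [n] of [K0 D] over the Laurent polynomials, with [q]
    acting through [X]. *)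
Definition K0_free D (X : autoequiv D) (n : nat) : Prop :=
  exists b : 'I_n -> K0 D,
    bijective (fun p : {ffun 'I_n -> laurent int} =>
      \sum_(i < n) laurent_sum (fun l m => qact X l (b i) *~ m) (p i)).

Definition is_qstability D (X : autoequiv D) (sigma : stabData D) (s : R[i])
  : Prop :=
  [/\ is_stability sigma,
      forall phi, slice sigma (phi + complex.Re s) = ess_im X (slice sigma phi)
    & forall a, charge sigma (qact X 1 a) = expipi s * charge sigma a].

Section QSupport.
Variables (D : triCategory k) (X : autoequiv D) (sigma : stabData D) (s : R[i]).
Variables (n : nat) (Gam : zmodType) (j : Gam -> K0 D).

Definition qpoly l (a : 'I_l.+1 -> Gam) : K0 D :=
  \sum_(i < l.+1) qact X i (j (a i)).

(** The lattice is given as a group [Gam] with its inclusion [j]. *)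
Record q_support : Prop := QSupport {
  qs_lattice : exists b : 'I_n -> Gam, is_Zbasis b;
  qs_incl : zmod_morphism j /\ injective j;
  qs_tensor : bijective (laurent_sum (fun l a => qact X l (j a)));
  qs_support : exists hss : set (K0 D),
    [/\ forall x, hss x -> exists l (a : 'I_l.+1 -> Gam), x = qpoly a,
        ss sigma = \bigcup_(l in [set: int]) (qact X l @` hss)
      & exists2 nrm : Gam -> R, lattice_norm nrm
        & exists2 c : R, 0 < c
        & forall l (a : 'I_l.+1 -> Gam), hss (qpoly a) ->
            \sum_(i < l.+1)
              ComplexField.Normc.normc (expipi (s *+ i)) * nrm (a i)
            < c * ComplexField.Normc.normc (charge sigma (qpoly a))];
  qs_hom : forall E, semistable sigma E -> range j (cls E) ->
    exists N0 : nat, forall F, stable sigma F -> range j (cls F) ->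
      forall l : int, (N0 < `|l|)%N ->
        (forall f : hom E (xpow X l F), f = 0) /\
        (forall f : hom F (xpow X l E), f = 0)
}.

End QSupport.

Section Induced.
Variables (D : triCategory k) (X : autoequiv D) (T : set D).
Hypothesis hT : baric_heart X T.

Definition heart : triCategory k := sub_tri (baric_sub hT).

Definition heart_ob (A : heart) : D := sval A.

Definition heart_incl : K0 heart -> K0 D :=
  K0lift (fun A : heart => cls (heart_ob A)).

(** The isomorphism to [K0 D] from the tensor product of [K0 heart] with the
    integral Laurent polynomials. *)
Definition heart_tensor : laurent (K0 heart) -> K0 D :=
  laurent_sum (fun l a => qact X l (heart_incl a)).

Variables (sigma : stabData heart) (s : R[i]).

(** Transports [charge sigma] tensored with the Laurent polynomials, evaluated
    at [q = exp (i pi s)], along the inverse of [heart_tensor]; the default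
    value of [xget] is never used as [heart_tensor] is bijective. *)
Definition induced_charge (a : K0 D) : R[i] :=
  laurent_sum (fun l x => expipi (s *~ l) * charge sigma x)
    (xget [fsfun] (heart_tensor @^-1` [set a])).

Definition induced_gen (phi : R) : set D :=
  \bigcup_(l in [set: int])
    ess_im (fun A => xpow X l (heart_ob A))
      (slice sigma (phi - l%:~R * complex.Re s)).

Definition sigma_oplus : stabData D :=
  StabData induced_charge (fun phi => add_closure (induced_gen phi)).

Definition sigma_star : stabData D :=
  StabData induced_charge (fun phi => ext_closure (induced_gen phi)).

End Induced.

End Stability.

Arguments hom_vanish {k D} P Q.
Arguments charge {R k D} s a.
Arguments slice {R k D} s phi.

(* Main.v *)
(** Write objects of the baric heart placed in level [l] as [X^l A]. A map from
    level [l] to level [l + 1] is Serre dual to a map of the heart in the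
    opposite direction, and maps from level [l] to level [l + 2] or more vanish.

    Sufficiency: refining the baric filtration of an object by Harder-Narasimhan
    filtrations in the heart gives semistable pieces ordered by level first. Two
    adjacent pieces in the wrong order of phase can be exchanged, as the gap
    condition kills their extension; pieces of equal phase are merged, and under
    the stronger condition of the additive case they form a direct sum.

    Necessity: a nonzero map [A -> B] violating the bound is dual to a nonsplit
    extension [M] of [B] by [X A [-1]]. Cutting [M] by phases and truncating the
    pieces by levels yields a second triangle on [M] with the levels in the
    opposite order, which forces the first one to split.

    Support: the exactness of the truncations by levels makes the class of the
    graded piece of level [l] additive on triangles, which inverts the map from
    the Laurent polynomials over the Grothendieck group of the heart. All the
    graded pieces of a semistable object have charges on the same ray, so the
    norm estimate of the heart adds up. *)

From mathcomp Require Import all_boot all_order all_algebra.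
From mathcomp Require Import all_classical all_reals all_analysis complex.
From mathcomp Require Import finmap freeg zify ring lra.
Require Import Defs.

Set Implicit Arguments.
Unset Strict Implicit.
Unset Printing Implicit Defensive.

Import Order.TTheory GRing.Theory Num.Theory.

Local Open Scope ring_scope.
Local Open Scope classical_set_scope.
Local Open Scope cat_scope.

(** * Linear and triangulated categories *)

(** Most steps are phrased as the vanishing of all maps between two objects, since this passes
    through isomorphisms, extensions, summands and Serre duality alike. The bound [r - 1], with [r]
    the real part of [s], comes from the shift: for a piece [F] of level [l + 1] and phase [phi] and
    a piece [G] of level [l] and phase [psi], the obstruction to exchanging them is a map [G ->
    F[1]], dual to a map of the heart that raises the phase by [psi - phi + r - 1]. Exchanging
    requires its vanishing for [phi < psi], splitting at equal phase requires it for [phi = psi]: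
    hence a strict and a nonstrict condition. Two obstacles shape the rest. Additive slices are
    closed under summands, but a splitting by levels does not visibly pass to summands; a
    factorization of the identity through the two level parts does, and it can be turned back into a
    splitting. And the lattice must have a basis of exactly [n] elements, while the support property
    of the heart provides a basis of unknown length; comparing ranks at [q = 1] identifies the two
    lengths. *)

Section LinearCategoryTheory.
Variables (k : fieldType) (C : linCategory k).
Implicit Types X Y Z : C.

Lemma comp0l X Y Z (f : hom X Y) : (0 : hom Y Z) ∘ f = 0.
Proof.
have := comp_linl f 1 (0 : hom Y Z) 0; rewrite !scale1r addr0.
by move/eqP; rewrite -subr_eq subrr eq_sym => /eqP.
Qed.

Lemma comp0r X Y Z (g : hom Y Z) : g ∘ (0 : hom X Y) = 0.
Proof.
have := comp_linr g 1 (0 : hom X Y) 0; rewrite !scale1r addr0.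
by move/eqP; rewrite -subr_eq subrr eq_sym => /eqP.
Qed.

Lemma compDl X Y Z (f : hom X Y) (g g' : hom Y Z) :
  (g + g') ∘ f = g ∘ f + g' ∘ f.
Proof. by have := comp_linl f 1 g g'; rewrite !scale1r. Qed.

Lemma compDr X Y Z (g : hom Y Z) (f f' : hom X Y) :
  g ∘ (f + f') = g ∘ f + g ∘ f'.
Proof. by have := comp_linr g 1 f f'; rewrite !scale1r. Qed.

Lemma compNl X Y Z (f : hom X Y) (g : hom Y Z) : (- g) ∘ f = - (g ∘ f).
Proof. by apply/eqP; rewrite -addr_eq0 -compDl addNr comp0l. Qed.

Lemma compNr X Y Z (g : hom Y Z) (f : hom X Y) : g ∘ (- f) = - (g ∘ f).
Proof. by apply/eqP; rewrite -addr_eq0 -compDr addNr comp0r. Qed.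

Lemma compBl X Y Z (f : hom X Y) (g g' : hom Y Z) :
  (g - g') ∘ f = g ∘ f - g' ∘ f.
Proof. by rewrite compDl compNl. Qed.

Lemma compBr X Y Z (g : hom Y Z) (f f' : hom X Y) :
  g ∘ (f - f') = g ∘ f - g ∘ f'.
Proof. by rewrite compDr compNr. Qed.

Lemma is_iso_id X : is_iso (idm X).
Proof. by exists (idm X); rewrite comp_idl. Qed.

Lemma is_isoN X Y (f : hom X Y) : is_iso f -> is_iso (- f).
Proof. by case=> g [gf fg]; exists (- g); rewrite !compNl !compNr !opprK. Qed.

Lemma is_iso_comp X Y Z (g : hom Y Z) (f : hom X Y) :
  is_iso g -> is_iso f -> is_iso (g ∘ f).
Proof.
case=> g' [g'g gg'] [f' [f'f ff']]; exists (f' ∘ g'); split.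
  by rewrite -comp_assoc (comp_assoc g') g'g comp_idl.
by rewrite -comp_assoc (comp_assoc f) ff' comp_idl.
Qed.

Lemma iso_refl X : iso X X.
Proof. by exists (idm X); exact: is_iso_id. Qed.

Lemma iso_sym X Y : iso X Y -> iso Y X.
Proof. by case=> f [g [gf fg]]; exists g, f. Qed.

Lemma iso_trans Y X Z : iso X Y -> iso Y Z -> iso X Z.
Proof. by case=> f f_iso [g g_iso]; exists (g ∘ f); exact: is_iso_comp. Qed.

Lemma zero_homr X Y (f : hom X Y) : is_zero Y -> f = 0.
Proof. by move=> Y0; rewrite -[f]comp_idl Y0 comp0l. Qed.

Lemma zero_homl X Y (f : hom X Y) : is_zero X -> f = 0.
Proof. by move=> X0; rewrite -[f]comp_idr X0 comp0r. Qed.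

Lemma zero_iso X Y : is_zero X -> is_zero Y -> iso X Y.
Proof.
by move=> X0 Y0; exists 0, 0; split; rewrite comp0r; [rewrite X0|rewrite Y0].
Qed.

Lemma iso_zero X Y : iso X Y -> is_zero X -> is_zero Y.
Proof.
case=> f [g [_ fg]] X0; rewrite /is_zero -fg.
by rewrite (zero_homl f X0) comp0l.
Qed.

Lemma is_iso_cancell X Y Z (f : hom Y Z) (u v : hom X Y) :
  is_iso f -> f ∘ u = f ∘ v -> u = v.
Proof.
by case=> g [gf _] fuv; rewrite -[u]comp_idl -gf -comp_assoc fuv comp_assoc gf
  comp_idl.
Qed.

Lemma is_iso_cancelr X Y Z (f : hom X Y) (u v : hom Y Z) :
  is_iso f -> u ∘ f = v ∘ f -> u = v.
Proof.
by case=> g [_ fg] fuv; rewrite -[u]comp_idr -fg comp_assoc fuv -comp_assoc fg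
  comp_idr.
Qed.

Lemma is_dsum_sym X Y S : is_dsum X Y S -> is_dsum Y X S.
Proof.
case=> i [j [p [q [pi qj qi pj e]]]]; exists j, i, q, p.
by split=> //; rewrite addrC.
Qed.

Lemma is_dsum_zerol X Y S : is_dsum X Y S -> is_zero S -> is_zero X.
Proof.
case=> i [j [p [q [pi _ _ _ _]]]] S0.
by rewrite /is_zero -pi (zero_homr i S0) comp0r.
Qed.

Lemma is_dsum_iso0 X Y Z : iso X Y -> is_zero Z -> is_dsum X Z Y.
Proof.
case=> f [g [gf fg]] Z0; exists f, 0, g, 0.
by split=> //; rewrite ?comp0l ?comp0r ?addr0 // Z0.
Qed.

End LinearCategoryTheory.

Section FunctorTheory.
Variable k : fieldType.
Implicit Types C D : linCategory k.

Section Functor.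
Variables (C D : linCategory k) (F : functor C D).
Implicit Types X Y : C.

Lemma fmapD X Y (f f' : hom X Y) : fmap F (f + f') = fmap F f + fmap F f'.
Proof. by have := fmap_lin F 1 f f'; rewrite !scale1r. Qed.

Lemma fmap0 X Y : fmap F (0 : hom X Y) = 0.
Proof.
have := fmapD (0 : hom X Y) 0; rewrite addr0.
by move/eqP; rewrite -subr_eq subrr eq_sym => /eqP.
Qed.

Lemma fmapN X Y (f : hom X Y) : fmap F (- f) = - fmap F f.
Proof. by apply/eqP; rewrite -addr_eq0 -fmapD addNr fmap0. Qed.

Lemma fmap_is_iso X Y (f : hom X Y) : is_iso f -> is_iso (fmap F f).
Proof.
by case=> g [gf fg]; exists (fmap F g); rewrite -!fmap_comp gf fg !fmap_id.
Qed.

Lemma fobj_iso X Y : iso X Y -> iso (F X) (F Y).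
Proof. by case=> f f_iso; exists (fmap F f); exact: fmap_is_iso. Qed.

Lemma fobj_zero X : is_zero X -> is_zero (F X).
Proof. by move=> X0; rewrite /is_zero -fmap_id X0 fmap0. Qed.

Lemma fobj_dsum X Y S : is_dsum X Y S -> is_dsum (F X) (F Y) (F S).
Proof.
case=> i [j [p [q [pi qj qi pj e]]]].
exists (fmap F i), (fmap F j), (fmap F p), (fmap F q).
by split; rewrite -!fmap_comp ?pi ?qj ?qi ?pj ?fmap_id ?fmap0 // -fmapD e fmap_id.
Qed.

End Functor.

Variable C : linCategory k.
Implicit Types (F : autoequiv C) (X Y : C).

Definition inv_autoequiv F : autoequiv C :=
  Autoequiv (fwdK F) (bwdK F).

Lemma fwd_bwd_iso F X : iso (F (bwd F X)) X.
Proof. by have [eta [_ /(_ X) ?]] := fwdK F; exists (eta X). Qed.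

Lemma bwd_fwd_iso F X : iso (bwd F (F X)) X.
Proof. exact: (fwd_bwd_iso (inv_autoequiv F)). Qed.

Lemma fmap_inj F X Y (f g : hom X Y) : fmap F f = fmap F g -> f = g.
Proof.
have [eta [nat_eta iso_eta]] := bwdK F => fg.
apply: (is_iso_cancelr (iso_eta X)).
have := nat_eta _ _ f; have := nat_eta _ _ g; rewrite /= fg => -> //.
Qed.

Lemma fmap_full F X Y (g : hom (F X) (F Y)) : exists f, fmap F f = g.
Proof.
have [eta [nat_eta iso_eta]] := bwdK F.
have [e [eX Xe]] := iso_eta X.
exists (eta Y ∘ fmap (bwd F) g ∘ e).
apply: (@fmap_inj (inv_autoequiv F)) => /=.
apply: (is_iso_cancell (iso_eta Y)).
have := nat_eta _ _ (eta Y ∘ fmap (bwd F) g ∘ e); rewrite /= => ->.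
by rewrite -comp_assoc eX comp_idr.
Qed.

Lemma fobj_iso_inj F X Y : iso (F X) (F Y) -> iso X Y.
Proof.
case=> f' [g' [gf fg]]; have [f def_f] := fmap_full f'.
have [g def_g] := fmap_full g'; exists f, g.
by split; apply: (@fmap_inj F); rewrite fmap_comp def_f def_g fmap_id.
Qed.

Lemma fobj_zero_inj F X : is_zero (F X) -> is_zero X.
Proof. by move=> FX0; apply: (@fmap_inj F); rewrite fmap_id fmap0. Qed.

End FunctorTheory.

(** * Calculus of distinguished triangles *)

Section TriangulatedTheory.
Variables (k : fieldType) (D : triCategory k).
Implicit Types A B E U V W : D.

Notation T := (shift D).

Definition orth A B : Prop := forall f : hom A B, f = 0.

Lemma dist_rotE A E B (f : hom A E) (g : hom E B) (h : hom B (T A)) :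
  dist f g h <-> dist g h (- fmap T f).
Proof. exact: (tr2 (triP D) f g h). Qed.

Section Triangle.
Variables (A E B : D) (f : hom A E) (g : hom E B) (h : hom B (T A)).
Hypothesis fgh : dist f g h.

Lemma dist_rot : dist g h (- fmap T f).
Proof. exact: (dist_rotE f g h).1. Qed.

Lemma dist_comp0 : g ∘ f = 0.
Proof.
have [N N0] := tr_zero (triP D).
have [c [cg _]] := tr3 (triP D) (a := idm A) (b := f)
  (tr1_id (triP D) A N0) fgh erefl.
by rewrite -cg comp0r.
Qed.

Lemma dist_colift W (u : hom E W) : u ∘ f = 0 -> exists w, u = w ∘ g.
Proof.
have [N N0] := tr_zero (triP D) => uf0.
have id_dist : dist (0 : hom N W) (idm W) 0.
  apply/dist_rotE; rewrite fmap0 oppr0.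
  exact/(tr1_id (triP D))/fobj_zero.
have [|c [cg _]] := tr3 (triP D) (a := 0) (b := u) fgh id_dist.
  by rewrite uf0 comp0r.
by exists c; rewrite cg comp_idl.
Qed.

End Triangle.

Lemma dist_lift A E B (f : hom A E) (g : hom E B) (h : hom B (T A)) W
  (u : hom W E) : dist f g h -> g ∘ u = 0 -> exists w, u = f ∘ w.
Proof.
have [N N0] := tr_zero (triP D) => fgh gu0.
have := dist_rot (tr1_id (triP D) W N0); rewrite fmap_id.
move=> id_dist.
have [|c [_]] := tr3 (triP D) (a := u) (b := (0 : hom N B)) id_dist (dist_rot fgh).
  by rewrite gu0 comp0r.
have [w <-] := fmap_full c; rewrite compNr compNl comp_idr.
by move=> /oppr_inj; rewrite -fmap_comp => /fmap_inj ->; exists w.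
Qed.

Lemma dist_comp0' A E B (f : hom A E) (g : hom E B) (h : hom B (T A)) :
  dist f g h -> h ∘ g = 0.
Proof. by move/dist_rot/dist_comp0. Qed.

Lemma dist_lift1 A E B (f : hom A E) (g : hom E B) (h : hom B (T A)) W
  (u : hom W B) : dist f g h -> h ∘ u = 0 -> exists w, u = g ∘ w.
Proof. by move/dist_rot/dist_lift; apply. Qed.

(** What [f] kills comes from the inverse shift of [B]; as the shift is only an equivalence, the
    factorization is stated after shifting [u]. *)
Lemma dist_lift2 A E B (f : hom A E) (g : hom E B) (h : hom B (T A)) W
  (u : hom W A) : dist f g h -> f ∘ u = 0 ->
  exists w : hom (T W) B, fmap T u = h ∘ w.
Proof.
move=> /dist_rot/dist_rot/dist_lift fgh fu0; apply: fgh.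
by rewrite compNl -fmap_comp fu0 fmap0 oppr0.
Qed.

Lemma dist_colift1 A E B (f : hom A E) (g : hom E B) (h : hom B (T A)) W
  (u : hom B W) : dist f g h -> u ∘ g = 0 -> exists w, u = w ∘ h.
Proof. by move/dist_rot/dist_colift; apply. Qed.

Lemma is_extP A E B (f : hom A E) (g : hom E B) (h : hom B (T A)) :
  dist f g h -> is_ext A E B.
Proof. by exists f, g, h. Qed.

Lemma is_ext_rot A E B : is_ext A E B <-> is_ext E B (T A).
Proof.
split=> [[f [g [h /dist_rot/is_extP]]]//|[g [h [f' fgh]]]].
have [f def_f] := fmap_full (- f'); exists f, g, h.
by apply/dist_rotE; rewrite def_f opprK.
Qed.

Lemma is_ext_shift A E B : is_ext A E B <-> is_ext (T A) (T E) (T B).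
Proof. by rewrite is_ext_rot is_ext_rot is_ext_rot. Qed.

Lemma is_ext_iso A E B A' E' B' : iso A A' -> iso E E' -> iso B B' ->
  is_ext A E B -> is_ext A' E' B'.
Proof.
move=> [a a_iso] [b b_iso] [c c_iso] [f [g [h fgh]]].
have [a' [a'a aa']] := a_iso; have [b' [b'b bb']] := b_iso.
have [c' [c'c cc']] := c_iso.
exists (b ∘ f ∘ a'), (c ∘ g ∘ b'), (fmap T a ∘ h ∘ c').
apply: (tr1_iso (triP D)) a_iso b_iso c_iso _ _ _ fgh.
- by rewrite -comp_assoc a'a comp_idr.
- by rewrite -comp_assoc b'b comp_idr.
- by rewrite -comp_assoc c'c comp_idr.
Qed.

Lemma is_ext_id0 A Z : is_zero Z -> is_ext A A Z.
Proof. by move=> Z0; exists (idm A), 0, 0; exact: (tr1_id (triP D)). Qed.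

Lemma is_ext_0id A Z : is_zero Z -> is_ext Z A A.
Proof. by move=> Z0; apply/is_ext_rot/is_ext_id0/fobj_zero. Qed.

Lemma cone_exists A E (f : hom A E) :
  exists B (g : hom E B) (h : hom B (T A)), dist f g h.
Proof. exact: (tr1_cone (triP D)). Qed.

Lemma cocone_exists E B (g : hom E B) :
  exists A (f : hom A E) (h : hom B (T A)), dist f g h.
Proof.
have [C [u [v guv]]] := cone_exists g.
(* The first vertex has to be an inverse shift of the cone [C]; the isomorphism [e] and the fullness
   of [T] replace a strict inverse. *)
have [e e_iso] := fwd_bwd_iso T C.
have [e' [e'e ee']] := e_iso.
have [f def_f] := fmap_full (- (v ∘ e)).
exists (bwd T C), f, (e' ∘ u); apply/dist_rotE.
rewrite def_f opprK.
apply: (tr1_iso (triP D)) (is_iso_id E) (is_iso_id B) _ _ _ _ guv;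
  first by exists e; exact: conj ee' e'e.
- by rewrite comp_idl comp_idr.
- by rewrite comp_idr.
- by rewrite fmap_id comp_idl -comp_assoc ee' comp_idr.
Qed.

(** This and the next lemma rebracket a filtration with factors [A], [B], [C]; exchanges of factors
    are built from them and [is_ext_swap]. *)
Lemma is_ext_octa A E B F C : is_ext A E B -> is_ext E F C ->
  exists2 Y, is_ext A F Y & is_ext B Y C.
Proof.
move=> [f [i [i' fi]]] [g [j [j' gj]]].
have [Y [l [l' gfl]]] := cone_exists (g ∘ f).
have [u [v [uv _ _ _ _]]] := tr4 (triP D) fi gj gfl.
by exists Y; [exact: is_extP gfl | exact: is_extP uv].
Qed.

Lemma is_ext_octa' A F Y B C : is_ext A F Y -> is_ext B Y C ->
  exists2 E, is_ext A E B & is_ext E F C.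
Proof.
move=> [f [g [h fgh]]] [i [j [l ijl]]].
have [E [a [b abl]]] := cocone_exists (j ∘ g).
(* The octahedron on [F -> Y -> C] has cones [T A], [T B] and [T E]; the shift is undone at the
   end. *)
have [u [v [uv _ _ _ _]]] :=
  tr4 (triP D) (dist_rot fgh) (dist_rot ijl) (dist_rot abl).
by exists E; [exact/is_ext_shift/(is_extP uv) | exact: is_extP abl].
Qed.

Lemma dist_split A E B (f : hom A E) (g : hom E B) : dist f g 0 ->
  exists (j : hom B E) (p : hom E A), [/\ p ∘ f = idm A, g ∘ j = idm B,
    g ∘ f = 0, p ∘ j = 0 & f ∘ p + j ∘ g = idm E].
Proof.
move=> fg0.
have [j gj] : exists j, idm B = g ∘ j.
  by apply: (dist_lift1 (u := idm B) fg0); rewrite comp0l.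
have [p fp] : exists p, idm E - j ∘ g = f ∘ p.
  apply: (dist_lift (u := idm E - j ∘ g) fg0).
  by rewrite compBr comp_assoc -gj comp_idl comp_idr subrr.
have f_mono W (u : hom W A) : f ∘ u = 0 -> u = 0.
  move=> /(dist_lift2 fg0)[w]; rewrite comp0l -(fmap0 T).
  exact: fmap_inj.
have gf := dist_comp0 fg0.
have pf : p ∘ f = idm A.
  apply/eqP; rewrite -subr_eq0; apply/eqP/f_mono.
  rewrite compBr comp_assoc -fp compBl comp_idl comp_idr -comp_assoc gf.
  by rewrite comp0r subr0 subrr.
have pj : p ∘ j = 0.
  apply: f_mono; rewrite comp_assoc -fp compBl comp_idl -comp_assoc -gj.
  by rewrite comp_idr subrr.
by exists j, p; split=> //; rewrite -fp subrK.
Qed.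

(** The axioms do not make a biproduct a triangle, so [i] is completed to one; the retraction [p]
    kills its connecting map, and [g ∘ j] identifies [B] with the cone. *)
Lemma is_ext_dsum A B S : is_dsum A B S -> is_ext A S B.
Proof.
case=> i [j [p [q [pi qj qi pj e]]]].
have [C [g [h igh]]] := cone_exists i.
have [c def_q] := dist_colift igh qi.
have h0 : h = 0.
  have := dist_comp0' (dist_rot igh); rewrite compNl => /eqP.
  rewrite oppr_eq0 => /eqP ih.
  by rewrite -[h]comp_idl -fmap_id -pi fmap_comp -comp_assoc ih comp0r.
have gi := dist_comp0 igh.
have cgj : c ∘ (g ∘ j) = idm B by rewrite comp_assoc -def_q.
have gjc : g ∘ j ∘ c = idm C.
  rewrite h0 in igh; have [s [_ [_ gs _ _ _]]] := dist_split igh.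
  rewrite -[LHS]comp_idr -gs comp_assoc -(comp_assoc _ c) -def_q -(comp_assoc g).
  have -> : j ∘ q = idm S - i ∘ p by rewrite -e addrC addKr.
  by rewrite compBr comp_idr comp_assoc (dist_comp0 igh) comp0l subr0.
apply: (is_ext_iso (iso_refl A) (iso_refl S) _ (is_extP igh)).
by exists c, (g ∘ j).
Qed.

Lemma is_ext_split A E B : is_ext A E B -> orth B (T A) -> is_dsum A B E.
Proof.
move=> [f [g [h fgh]]] BA0; rewrite (BA0 h) in fgh.
by have [j [p ?]] := dist_split fgh; exists f, j, p, g.
Qed.

Lemma orth_isol A A' B : iso A A' -> orth A B -> orth A' B.
Proof.
move=> [a [a' [a'a aa']]] AB f; rewrite -[f]comp_idr -aa' comp_assoc.
by rewrite (AB (f ∘ a)) comp0l.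
Qed.

Lemma orth_isor A B B' : iso B B' -> orth A B -> orth A B'.
Proof.
move=> [b [b' [b'b bb']]] AB f; rewrite -[f]comp_idl -bb' -comp_assoc.
by rewrite (AB (b' ∘ f)) comp0r.
Qed.

Lemma orth_autoequiv (F : autoequiv D) A B : orth (F A) (F B) <-> orth A B.
Proof.
split=> AB f; first by apply: (@fmap_inj _ _ F); rewrite (AB (fmap F f)) fmap0.
by have [g <-] := fmap_full f; rewrite (AB g) fmap0.
Qed.

Lemma orth_zerol A B : is_zero A -> orth A B.
Proof. by move=> A0 f; exact: zero_homl. Qed.

Lemma orth_zeror A B : is_zero B -> orth A B.
Proof. by move=> B0 f; exact: zero_homr. Qed.

Lemma orth_self A : orth A A -> is_zero A.
Proof. exact. Qed.

Lemma orth_extl A E B W : is_ext A E B -> orth A W -> orth B W -> orth E W.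
Proof.
move=> [f [g [h fgh]]] AW BW u; have [w ->] := dist_colift fgh (AW (u ∘ f)).
by rewrite (BW w) comp0l.
Qed.

Lemma orth_extr A E B W : is_ext A E B -> orth W A -> orth W B -> orth W E.
Proof.
move=> [f [g [h fgh]]] WA WB u; have [w ->] := dist_lift fgh (WB (g ∘ u)).
by rewrite (WA w) comp0r.
Qed.

Lemma orth_dsuml A B S W : is_dsum A B S -> orth A W -> orth B W -> orth S W.
Proof. by move/is_ext_dsum; exact: orth_extl. Qed.

Lemma orth_dsumr A B S W : is_dsum A B S -> orth W A -> orth W B -> orth W S.
Proof. by move/is_ext_dsum; exact: orth_extr. Qed.

Lemma orth_summandl A B S W : is_dsum A B S -> orth S W -> orth A W.
Proof.
case=> i [_ [p [_ [pi _ _ _ _]]]] SW f.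
by rewrite -[f]comp_idr -pi comp_assoc (SW (f ∘ p)) comp0l.
Qed.

Lemma orth_summandr A B S W : is_dsum A B S -> orth W S -> orth W A.
Proof.
case=> i [_ [p [_ [pi _ _ _ _]]]] WS f.
by rewrite -[f]comp_idl -pi -comp_assoc (WS (i ∘ f)) comp0r.
Qed.

Lemma is_ext_zero A E B : is_ext A E B -> is_zero A -> is_zero B -> is_zero E.
Proof.
by move=> AEB A0 B0; apply/orth_self/(orth_extl AEB); exact: orth_zerol.
Qed.

Lemma is_ext_iso0l A E B : is_ext A E B -> is_zero A -> iso E B.
Proof.
move=> [f [g [h fgh]]] A0.
have [j gj] : exists j, idm B = g ∘ j.
  by apply: (dist_lift1 (u := idm B) fgh); apply/zero_homr/fobj_zero.
exists g, j; split=> //.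
have [|w] := dist_lift (u := j ∘ g - idm E) fgh.
  by rewrite compBr comp_assoc -gj comp_idl comp_idr subrr.
by rewrite (zero_homr w A0) comp0r => /eqP; rewrite subr_eq0 => /eqP.
Qed.

Lemma is_ext_iso0r A E B : is_ext A E B -> is_zero B -> iso A E.
Proof.
move=> /is_ext_rot/is_ext_rot/is_ext_iso0l BAE B0.
by apply: (@fobj_iso_inj _ _ T); apply/iso_sym/iso_sym/BAE.
Qed.

(** When [A -> E] vanishes, [T A] is a summand of [B]. *)
Lemma is_ext_zerol A E B : is_ext A E B -> orth A E -> orth (T A) B -> is_zero A.
Proof.
move=> [f [g [h fgh]]] AE TAB; apply: (@fobj_zero_inj _ _ T).
have [w w1] : exists w, fmap T (idm A) = h ∘ w.
  by apply: dist_lift2 fgh _; exact: AE.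
by rewrite fmap_id (TAB w) comp0r in w1.
Qed.

Lemma is_ext_zeror A E B : is_ext A E B -> orth E B -> orth (T A) B -> is_zero B.
Proof.
move=> [f [g [h fgh]]] EB TAB.
have [w w1] : exists w, idm B = w ∘ h.
  by apply: (dist_colift1 (u := idm B) fgh); rewrite (EB (_ ∘ _)).
by rewrite (TAB w) comp0l in w1.
Qed.

Lemma is_ext_swap A E B : is_ext A E B -> orth B (T A) -> is_ext B E A.
Proof. by move=> AEB /(is_ext_split AEB)/is_dsum_sym/is_ext_dsum. Qed.

(** [E] has successive factors [U'], [V'], [U''], [V'']. The vanishing splits the middle extension,
    so [V'] and [U''] trade places and the factors are regrouped in pairs. *)
Lemma is_ext_grid E' E E'' U' V' U'' V'' : is_ext E' E E'' ->
  is_ext U' E' V' -> is_ext U'' E'' V'' -> orth U'' (T V') ->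
  exists U V, [/\ is_ext U E V, is_ext U' U U'' & is_ext V' V V''].
Proof.
move=> E3 E1 E2 UV; have [Y UEY VYE] := is_ext_octa E1 E3.
have [Y' VYU YYV] := is_ext_octa' VYE E2.
have [V UYV VVV] := is_ext_octa (is_ext_swap VYU UV) YYV.
by have [U UUU UEV] := is_ext_octa' UEY UYV; exists U, V.
Qed.

(** The crossed vanishings factor each pair of maps through the other. The composites are
    identities: if [u ∘ x = u], then [x - idm U] factors, after a shift, through a map
    [T U -> V]. *)
Lemma trunc_maps U E V U' V' (u : hom U E) (v : hom E V) (w : hom V (T U))
  (u' : hom U' E) (v' : hom E V') (w' : hom V' (T U')) :
  dist u v w -> dist u' v' w' -> orth U V' -> orth U' V ->
  orth (T U) V -> orth (T U') V' ->
  (exists2 a : hom U U', is_iso a & u = u' ∘ a) /\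
  (exists2 c : hom V V', is_iso c & v' = c ∘ v).
Proof.
move=> uvw uvw' UV' U'V TUV TUV'.
have [a ua] := dist_lift uvw' (UV' (v' ∘ u)).
have [b ub] := dist_lift uvw (U'V (v ∘ u')).
have [c vc] := dist_colift uvw (UV' (v' ∘ u)).
have [d vd] := dist_colift uvw' (U'V (v ∘ u')).
have u_mono x : u ∘ x = u -> x = idm U.
  move=> ux; apply/(@fmap_inj _ _ T)/eqP; rewrite -subr_eq0 -fmapN -fmapD.
  have [|y ->] := dist_lift2 (u := x - idm U) uvw.
    by rewrite compBr ux comp_idr subrr.
  by rewrite (TUV y) comp0r.
have u_mono' x : u' ∘ x = u' -> x = idm U'.
  move=> ux; apply/(@fmap_inj _ _ T)/eqP; rewrite -subr_eq0 -fmapN -fmapD.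
  have [|y ->] := dist_lift2 (u := x - idm U') uvw'.
    by rewrite compBr ux comp_idr subrr.
  by rewrite (TUV' y) comp0r.
have v_epi x : x ∘ v = v -> x = idm V.
  move=> xv; apply/eqP; rewrite -subr_eq0.
  have [|y ->] := dist_colift1 (u := x - idm V) uvw.
    by rewrite compBl xv comp_idl subrr.
  by rewrite (TUV y) comp0l.
have v_epi' x : x ∘ v' = v' -> x = idm V'.
  move=> xv; apply/eqP; rewrite -subr_eq0.
  have [|y ->] := dist_colift1 (u := x - idm V') uvw'.
    by rewrite compBl xv comp_idl subrr.
  by rewrite (TUV' y) comp0l.
split.
  exists a => //; exists b; split.
    by apply: u_mono; rewrite comp_assoc -ub.
  by apply: u_mono'; rewrite comp_assoc -ua.
exists c => //; exists d; split.
  by apply: v_epi; rewrite -comp_assoc -vc.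
by apply: v_epi'; rewrite -comp_assoc -vd.
Qed.

Lemma trunc_uniq U E V U' V' : is_ext U E V -> is_ext U' E V' ->
  orth U V' -> orth U' V -> orth (T U) V -> orth (T U') V' ->
  iso U U' /\ iso V V'.
Proof.
move=> [u [v [w uvw]]] [u' [v' [w' uvw']]] UV' U'V TUV TUV'.
have [[a a_iso _] [c c_iso _]] := trunc_maps uvw uvw' UV' U'V TUV TUV'.
by split; [exists a | exists c].
Qed.

(** The difference [c - idm B] factors through [h], and [h] kills it, so it squares to zero and
    [2 - c] inverts [c]. *)
Lemma dist_unipotent A E B (f : hom A E) (g : hom E B) (h : hom B (T A))
  (c : hom B B) : dist f g h -> c ∘ g = g -> h ∘ c = h -> is_iso c.
Proof.
move=> fgh cg hc.
have [|w def_c] := dist_colift1 (u := c - idm B) fgh.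
  by rewrite compBl cg comp_idl subrr.
have c2 : (c - idm B) ∘ (c - idm B) = 0.
  by rewrite {1}def_c -comp_assoc compBr hc comp_idr subrr comp0r.
have e : c ∘ c = c + c - idm B.
  move: c2; rewrite compBl !compBr comp_idl !comp_idr => /eqP.
  by rewrite subr_eq0 subr_eq addrAC => /eqP.
by exists (idm B + idm B - c); rewrite compBl compBr compDl compDr !comp_idl
  !comp_idr e opprB addrCA subrr addr0.
Qed.

(** The maps that [tr3] gives in both directions may fail to be mutually inverse, but their
    composites are unipotent, so [c] is invertible on both sides. *)
Lemma cone_uniq A E B A' E' B' (f : hom A E) (g : hom E B) (h : hom B (T A))
  (f' : hom A' E') (g' : hom E' B') (h' : hom B' (T A'))
  (a : hom A A') (b : hom E E') : dist f g h -> dist f' g' h' ->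
  is_iso a -> is_iso b -> b ∘ f = f' ∘ a -> iso B B'.
Proof.
move=> fgh fgh' [a' [a'a aa']] [b' [b'b bb']] bf.
have [c [cg hc]] := tr3 (triP D) fgh fgh' bf.
have bf' : b' ∘ f' = f ∘ a'.
  by rewrite -[b' ∘ f']comp_idr -aa' comp_assoc -(comp_assoc b') -bf comp_assoc
    b'b comp_idl.
have [c' [c'g hc']] := tr3 (triP D) fgh' fgh bf'.
have [|| d [dcc ccd]] := dist_unipotent (c := c' ∘ c) fgh.
- by rewrite -comp_assoc cg comp_assoc c'g -comp_assoc b'b comp_idr.
- by rewrite comp_assoc -hc' -comp_assoc -hc comp_assoc -fmap_comp a'a fmap_id
    comp_idl.
have [|| d' [dcc' ccd']] := dist_unipotent (c := c ∘ c') fgh'.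
- by rewrite -comp_assoc c'g comp_assoc cg -comp_assoc bb' comp_idr.
- by rewrite comp_assoc -hc -comp_assoc -hc' comp_assoc -fmap_comp aa' fmap_id
    comp_idl.
have e : d ∘ c' = c' ∘ d'.
  rewrite -[d ∘ c']comp_idr -ccd' comp_assoc -(comp_assoc d) (comp_assoc c').
  by rewrite comp_assoc dcc comp_idl.
by exists c, (d ∘ c'); split; [rewrite -comp_assoc | rewrite e comp_assoc].
Qed.

(** * Exact autoequivalences *)

Section ExactAutoequivalence.
Variable F : autoequiv D.
Hypothesis F_exact : exact_functor F.

Lemma exact_iso_shift A : iso (F (T A)) (T (F A)).
Proof. by have [theta [_ iso_theta _]] := F_exact; exists (theta A). Qed.

(** For the converse only [f'] is lifted: the image of the cone of its lift is a cone of [f'], hence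
    isomorphic to [F B]. *)
Lemma exact_ext A E B : is_ext A E B <-> is_ext (F A) (F E) (F B).
Proof.
have [theta [_ _ thetaP]] := F_exact; split=> [[f [g [h /thetaP/is_extP]]]//|].
move=> [f' [g' [h' fgh']]]; have [f def_f] := fmap_full f'.
have [C [g [h fgh]]] := cone_exists f.
apply: (is_ext_iso (iso_refl A) (iso_refl E) _ (is_extP fgh)).
apply: (@fobj_iso_inj _ _ F).
apply: (cone_uniq (thetaP _ _ _ _ _ _ fgh) fgh' (is_iso_id _) (is_iso_id _)).
by rewrite comp_idl comp_idr.
Qed.

Lemma exact_ext_bwd A E B : is_ext A E B ->
  is_ext (bwd F A) (bwd F E) (bwd F B).
Proof.
move=> AEB; apply/exact_ext; apply: is_ext_iso AEB; apply/iso_sym;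
exact: fwd_bwd_iso.
Qed.

Lemma exact_bwd_iso_shift A : iso (bwd F (T A)) (T (bwd F A)).
Proof.
apply: (@fobj_iso_inj _ _ F); apply: iso_trans (fwd_bwd_iso _ _) _.
apply: iso_trans (iso_sym (exact_iso_shift _)).
exact/fobj_iso/iso_sym/fwd_bwd_iso.
Qed.

End ExactAutoequivalence.

(** * Extension and additive closures *)

Section Closures.
Implicit Types P Q : set D.

Lemma ext_closure_ind_sub P Q : (forall E, P E -> Q E) ->
  (forall E, is_zero E -> Q E) ->
  (forall A E B, is_ext A E B -> Q A -> Q B -> Q E) ->
  forall E, ext_closure P E -> Q E.
Proof. by move=> PQ Q0 Qx E; elim=> // A B E' /Qx AEB _ QA _; exact: AEB. Qed.

Lemma add_closure_ind_sub P Q : (forall E, P E -> Q E) ->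
  (forall E, is_zero E -> Q E) ->
  (forall A B S, is_dsum A B S -> Q A -> Q B -> Q S) ->
  (forall A B S, is_dsum A B S -> Q S -> Q A) ->
  forall E, add_closure P E -> Q E.
Proof.
move=> PQ Q0 Qs Qr E; elim=> {E}//[A B E /Qs AEB _ QA _ QB|A B E /Qr AEB _ QA].
  exact: AEB.
exact: AEB.
Qed.

Lemma ext_closure_sub P Q : (forall E, P E -> ext_closure Q E) ->
  forall E, ext_closure P E -> ext_closure Q E.
Proof.
move=> PQ; apply: ext_closure_ind_sub PQ _ _; first exact: Ext_zero.
by move=> A E B; exact: Ext_ext.
Qed.

Lemma add_closure_sub P Q : (forall E, P E -> add_closure Q E) ->
  forall E, add_closure P E -> add_closure Q E.
Proof.
move=> PQ; apply: add_closure_ind_sub PQ _ _ _;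
by [exact: Add_zero|exact: Add_sum|exact: Add_summand].
Qed.

Lemma ext_closure_iso P A B : iso A B -> ext_closure P A -> ext_closure P B.
Proof.
have [Z Z0] := tr_zero (triP D) => AB PA.
apply: (Ext_ext _ PA (Ext_zero P Z0)).
by apply: is_ext_iso (is_ext_id0 A Z0) => //; exact: iso_refl.
Qed.

Lemma add_closure_iso P A B : iso A B -> add_closure P A -> add_closure P B.
Proof.
have [Z Z0] := tr_zero (triP D) => /iso_sym AB PA.
exact: Add_summand (is_dsum_iso0 AB Z0) PA.
Qed.

Lemma ext_closure_additive P : additive_sub (ext_closure P).
Proof.
split=> [X Y||X Y S /is_ext_dsum]; [exact: ext_closure_iso| |exact: Ext_ext].
by have [Z Z0] := tr_zero (triP D); exists Z => //; exact: Ext_zero.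
Qed.

Lemma add_closure_additive P : additive_sub (add_closure P).
Proof.
split=> [X Y||X Y S]; [exact: add_closure_iso| |exact: Add_sum].
by have [Z Z0] := tr_zero (triP D); exists Z => //; exact: Add_zero.
Qed.

Lemma ext_closure_orth P Q : (forall A B, P A -> Q B -> orth A B) ->
  forall A B, ext_closure P A -> ext_closure Q B -> orth A B.
Proof.
move=> PQ A B PA QB; move: A PA; apply: ext_closure_ind_sub => [A PA|A|A E A'].
- move: B QB; apply: ext_closure_ind_sub => [B|B|B E B']; [exact: PQ| |].
    exact: orth_zeror.
  exact: orth_extr.
- exact: orth_zerol.
- exact: orth_extl.
Qed.

Lemma add_closure_orth P Q : (forall A B, P A -> Q B -> orth A B) ->
  forall A B, add_closure P A -> add_closure Q B -> orth A B.
Proof.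
move=> PQ A B PA QB; move: A PA.
apply: add_closure_ind_sub => [A PA|A|A E S|A E S].
- move: B QB; apply: add_closure_ind_sub => [B|B|B E S|B E S];
  [exact: PQ|exact: orth_zeror|exact: orth_dsumr|exact: orth_summandr].
- exact: orth_zerol.
- exact: orth_dsuml.
- exact: orth_summandl.
Qed.

Section Autoequivalence.
Variable F : autoequiv D.

Lemma add_closure_ess_im P Q : ess_im F P = Q ->
  ess_im F (add_closure P) = add_closure Q.
Proof.
move=> PQ; apply/seteqP; split=> E.
  move=> [A PA] AE; apply: add_closure_iso AE _; move: A PA {E}.
  apply: add_closure_ind_sub => [A PA|A A0|A B S AB|A B S AB].
  - by apply: Add_gen; rewrite -PQ; exists A => //; exact: iso_refl.
  - exact/Add_zero/fobj_zero.
  - exact/Add_sum/fobj_dsum.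
  - exact/Add_summand/(fobj_dsum F AB).
move=> QE; exists (bwd F E); last exact: fwd_bwd_iso.
move: E QE; apply: add_closure_ind_sub => [E|A A0|A B S AB|A B S AB].
- rewrite -PQ => -[A PA AE]; apply: add_closure_iso (Add_gen PA).
  apply: iso_trans (iso_sym (bwd_fwd_iso F A)) _.
  exact: (fobj_iso (bwd F)).
- exact/Add_zero/(fobj_zero (bwd F)).
- exact/Add_sum/(fobj_dsum (bwd F)).
- exact/Add_summand/(fobj_dsum (bwd F) AB).
Qed.

Lemma ext_closure_ess_im P Q : exact_functor F -> ess_im F P = Q ->
  ess_im F (ext_closure P) = ext_closure Q.
Proof.
move=> F_exact PQ; apply/seteqP; split=> E.
  move=> [A PA] AE; apply: ext_closure_iso AE _; move: A PA {E}.
  apply: ext_closure_ind_sub => [A PA|A A0|A S B /(exact_ext F_exact)].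
  - by apply: Ext_gen; rewrite -PQ; exists A => //; exact: iso_refl.
  - exact/Ext_zero/fobj_zero.
  - exact: Ext_ext.
move=> QE; exists (bwd F E); last exact: fwd_bwd_iso.
move: E QE; apply: ext_closure_ind_sub => [E|A A0|A S B].
- rewrite -PQ => -[A PA AE]; apply: ext_closure_iso (Ext_gen PA).
  apply: iso_trans (iso_sym (bwd_fwd_iso F A)) _.
  exact: (fobj_iso (bwd F)).
- exact/Ext_zero/(fobj_zero (bwd F)).
- by move/(exact_ext_bwd F_exact); exact: Ext_ext.
Qed.

Lemma ess_im_stable (P : set D) :
  (forall A B, iso A B -> P A -> P B) -> (forall A, P A <-> P (F A)) ->
  ess_im F P = P.
Proof.
move=> isoP PF; apply/seteqP; split=> E; first by case=> A /PF PA /isoP; apply.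
move=> PE; exists (bwd F E); last exact: fwd_bwd_iso.
by apply/PF; apply: isoP PE; apply/iso_sym; exact: fwd_bwd_iso.
Qed.

Lemma ext_closure_stable (P : set D) :
  exact_functor F -> (forall A B, iso A B -> P A -> P B) ->
  (forall A, P A <-> P (F A)) ->
  forall A, ext_closure P A <-> ext_closure P (F A).
Proof.
move=> F_exact isoP PF.
have e := ext_closure_ess_im F_exact (ess_im_stable isoP PF); move=> A.
split=> [PA|]; first by rewrite -e; exists A => //; exact: iso_refl.
rewrite -{1}e => -[B PB /fobj_iso_inj BA]; exact: ext_closure_iso BA PB.
Qed.

End Autoequivalence.

End Closures.

(** Three rotations negate all three maps. Changing the sign of the middle vertex absorbs two of the
    signs; the third is the sign of the natural isomorphism. *)
Lemma shift_exact : exact_functor T.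
Proof.
exists (fun X => - idm (T (T X))); split=> [X Y f|X|A E B f g h fgh].
- by rewrite /= compNl compNr comp_idl comp_idr.
- exact/is_isoN/is_iso_id.
- rewrite compNl comp_idl.
  apply: (tr1_iso (triP D) (is_iso_id _) (is_isoN (is_iso_id _)) (is_iso_id _)
    _ _ _ (dist_rot (dist_rot (dist_rot fgh)))).
  + by rewrite compNl compNr opprK comp_idl comp_idr.
  + by rewrite !compNr comp_idl comp_idr.
  + by rewrite fmap_id comp_idl comp_idr.
Qed.

End TriangulatedTheory.

(** * Grothendieck groups *)

Section Morphism.
Variables (U V : zmodType) (f : U -> V).
Hypothesis f_morph : zmod_morphism f.

Lemma zmod_morph0 : f 0 = 0.
Proof. by rewrite -(subrr 0) f_morph subrr. Qed.

Lemma zmod_morphN x : f (- x) = - f x.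
Proof. by rewrite -sub0r f_morph zmod_morph0 sub0r. Qed.

Lemma zmod_morphD x y : f (x + y) = f x + f y.
Proof. by rewrite -[y]opprK f_morph zmod_morphN !opprK. Qed.

Lemma zmod_morph_sum I (r : seq I) (P : pred I) (F : I -> U) :
  f (\sum_(i <- r | P i) F i) = \sum_(i <- r | P i) f (F i).
Proof. exact: (big_morph f zmod_morphD zmod_morph0). Qed.

Lemma zmod_morphMn x n : f (x *+ n) = f x *+ n.
Proof. by elim: n => [|n IH]; rewrite ?zmod_morph0// !mulrS zmod_morphD IH. Qed.

Lemma zmod_morphMz x (n : int) : f (x *~ n) = f x *~ n.
Proof. by case: n => n; rewrite ?NegzE ?mulrNz ?zmod_morphN zmod_morphMn. Qed.

End Morphism.

Section GrothendieckTheory.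
Variables (k : fieldType) (D : triCategory k).

Lemma cls_zero (E : D) : is_zero E -> cls E = 0.
Proof.
move=> E0; have /cls_ext := is_ext_id0 E E0.
by move/eqP; rewrite -subr_eq subrr eq_sym => /eqP.
Qed.

Lemma cls_iso (A B : D) : iso A B -> cls A = cls B.
Proof.
have [Z Z0] := tr_zero (triP D) => AB.
have := is_ext_iso (iso_refl A) AB (iso_refl Z) (is_ext_id0 A Z0).
by move/cls_ext; rewrite (cls_zero Z0) addr0.
Qed.

Lemma cls_dsum (A B S : D) : is_dsum A B S -> cls S = cls A + cls B.
Proof. by move/is_ext_dsum/cls_ext. Qed.

Lemma K0_ind (P : K0 D -> Prop) : P 0 ->
  (forall x y, P x -> P y -> P (x - y)) -> (forall E, P (cls E)) ->
  forall x, P x.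
Proof.
move=> P0 PB Pcls.
have PN x : P x -> P (- x) by move=> Px; rewrite -sub0r; exact: PB.
have PD x y : P x -> P y -> P (x + y).
  by move=> Px Py; rewrite -[y]opprK; apply: PB => //; exact: PN.
have Pn x n : P x -> P (x *+ n).
  by move=> Px; elim: n => // n; rewrite mulrS; exact: PD.
have Pz x (n : int) : P x -> P (x *~ n).
  by move=> Px; case: n => n; rewrite ?NegzE ?mulrNz; do ?apply: PN; exact: Pn.
move=> x; rewrite -[x]quot_reprK.
rewrite -[repr x]freeg_sumE raddf_sum; elim/big_rec: _ => // E y _ Py.
apply: PD => //; rewrite -[coeff E _]intz -freeg_mulz raddfMz; exact/Pz/Pcls.
Qed.

End GrothendieckTheory.

(** * Powers of the autoequivalence and the action of [q] *)

Section Powers.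
Variables (k : fieldType) (D : triCategory k) (X : autoequiv D).
Implicit Types (A B E : D) (l m : int).

(** The property concerns the function [xpow X l] itself, so that a single induction covers the
    iterates of [X] and of its inverse. *)
Lemma xpow_rec (Phi : (D -> D) -> Prop) : Phi id ->
  (forall f, Phi f -> Phi (fun E => X (f E))) ->
  (forall f, Phi f -> Phi (fun E => bwd X (f E))) ->
  forall l, Phi (xpow X l).
Proof.
move=> Phi0 PhiX PhiY [] n /=; first by elim: n => //= n; exact: PhiX.
by apply: (PhiY); elim: n => //= n; exact: PhiY.
Qed.

Lemma xpow_iso l A B : iso A B -> iso (xpow X l A) (xpow X l B).
Proof.
move: l A B.
apply: (xpow_rec (Phi := fun g => forall A B, iso A B -> iso (g A) (g B)))
  => // f IH A B /IH; first exact: fobj_iso.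
exact: (fobj_iso (bwd X)).
Qed.

Lemma xpow_zero l A : is_zero (xpow X l A) <-> is_zero A.
Proof.
move: l A; apply: (xpow_rec (Phi := fun g => forall A, is_zero (g A) <-> is_zero A))
  => // f IH A; rewrite -(IH A); split.
- exact: fobj_zero_inj.
- exact: fobj_zero.
- exact: (@fobj_zero_inj _ _ (inv_autoequiv X)).
- exact: (fobj_zero (bwd X)).
Qed.

Lemma xpow_orth l A B : orth (xpow X l A) (xpow X l B) <-> orth A B.
Proof.
move: l A B.
apply: (xpow_rec (Phi := fun g => forall A B, orth (g A) (g B) <-> orth A B))
  => // f IH A B; rewrite -(IH A B).
  exact: orth_autoequiv.
exact: (orth_autoequiv (inv_autoequiv X)).
Qed.

Lemma xpowS l A : iso (xpow X (l + 1) A) (X (xpow X l A)).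
Proof.
case: l => [n|[|n]].
- by rewrite -PoszD addn1; exact: iso_refl.
- exact/iso_sym/fwd_bwd_iso.
- rewrite (_ : Negz n.+1 + 1 = Negz n); first exact/iso_sym/fwd_bwd_iso.
  by rewrite !NegzE -[n.+2]addn1 PoszD opprD addrNK.
Qed.

Lemma xpowD l m A : iso (xpow X (l + m) A) (xpow X l (xpow X m A)).
Proof.
elim/int_ind: l A => [|n IH|n IH] A; first by rewrite add0r; exact: iso_refl.
  rewrite -addn1 PoszD addrAC; apply: iso_trans (xpowS _ _) _.
  by apply: iso_trans (iso_sym (xpowS _ _)); exact: fobj_iso.
apply: (@fobj_iso_inj _ _ X); apply: iso_trans (iso_sym (xpowS _ _)) _.
apply: iso_trans (xpowS _ _).
rewrite addrAC (_ : - n.+1%:Z + 1 = - n%:Z) //.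
by rewrite -addn1 PoszD opprD addrNK.
Qed.

Lemma xpowK l A : iso (xpow X l (xpow X (- l) A)) A.
Proof.
by apply: iso_trans (iso_sym (xpowD _ _ _)) _; rewrite subrr; exact: iso_refl.
Qed.

Lemma xpowVK l A : iso (xpow X (- l) (xpow X l A)) A.
Proof. by have := xpowK (- l) A; rewrite opprK. Qed.

Lemma xpow_succ l A : iso (xpow X (l + 1) A) (xpow X l (X A)).
Proof. exact: xpowD l 1 A. Qed.

Section Exact.
Hypothesis X_exact : exact_functor X.

Lemma xpow_ext l A E B : is_ext A E B <->
  is_ext (xpow X l A) (xpow X l E) (xpow X l B).
Proof.
have ext m A' E' B' : is_ext A' E' B' ->
    is_ext (xpow X m A') (xpow X m E') (xpow X m B').
  move: m A' E' B'.
  apply: (xpow_rec (Phi := fun g => forall A E B,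
    is_ext A E B -> is_ext (g A) (g E) (g B))) => // f IH A' E' B' /IH.
    by move/(exact_ext X_exact).
  exact: exact_ext_bwd.
split=> [|/(ext (- l))]; first exact: ext.
by apply: is_ext_iso; exact: xpowVK.
Qed.

Lemma xpow_shift l A : iso (xpow X l (shift D A)) (shift D (xpow X l A)).
Proof.
move: l A; apply: (xpow_rec (Phi := fun g => forall A,
  iso (g (shift D A)) (shift D (g A)))) => [|f IH|f IH] A; first exact: iso_refl.
  exact: iso_trans (fobj_iso _ (IH A)) (exact_iso_shift X_exact _).
by apply: iso_trans (fobj_iso (bwd X) (IH A)) (exact_bwd_iso_shift X_exact _).
Qed.

Lemma qact_additive l : additive_on_triangles (fun E => cls (xpow X l E)).
Proof. by move=> A E B /(xpow_ext l)/cls_ext. Qed.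

Lemma qact_cls l E : qact X l (cls E) = cls (xpow X l E).
Proof. exact/K0lift_cls/qact_additive. Qed.

Lemma qact_morph l : zmod_morphism (qact X l).
Proof. exact/K0lift_is_zmod_morphism/qact_additive. Qed.

Lemma qactD l m x : qact X (l + m) x = qact X l (qact X m x).
Proof.
elim/K0_ind: x => [|x y IHx IHy|E].
- by rewrite !(zmod_morph0 (qact_morph _)).
- by rewrite !qact_morph IHx IHy.
- by rewrite !qact_cls; exact/cls_iso/xpowD.
Qed.

Lemma qact0 x : qact X 0 x = x.
Proof.
elim/K0_ind: x => [|x y IHx IHy|E]; last exact: qact_cls.
  exact: zmod_morph0 (qact_morph _).
by rewrite qact_morph IHx IHy.
Qed.

End Exact.

End Powers.

(** * Truncation by levels *)

Lemma filtered_ext_closure (k : fieldType) (D : triCategory k) (I : eqType)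
    (P : I -> set D) (Q : set D) t E : filtered P t E ->
  (forall i A, i \in t -> P i A -> Q A) -> ext_closure Q E.
Proof.
elim=> {t E}[E E0 _|t i E' E A _ IH E'EA PA PQ]; first exact: Ext_zero.
apply: Ext_ext E'EA _ (Ext_gen _); last by apply: PQ PA; rewrite mem_rcons mem_head.
by apply: IH => j B jt; apply: PQ; rewrite mem_rcons inE jt orbT.
Qed.

Section Truncation.
Variables (k : fieldType) (D : triCategory k).
Implicit Types (U V : set D).

(** Both [U] and [V] being stable under shifts in both directions, these are
    the axioms of a semiorthogonal pair. *)
Record semiorthogonal U V : Prop := Semiorthogonal {
  so_orth : forall A B, U A -> V B -> orth A B;
  so_shiftU : forall A, U A <-> U (shift D A);
  so_shiftV : forall A, V A <-> V (shift D A);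
  so_extU : forall A E B, is_ext A E B -> U A -> U B -> U E;
  so_extV : forall A E B, is_ext A E B -> V A -> V B -> V E
}.

Section Pair.
Variables (U V : set D).
Hypothesis so : semiorthogonal U V.

Lemma so_orthT A B : U A -> V B -> orth A (shift D B).
Proof. by move=> UA /(so_shiftV so); exact: (so_orth so). Qed.

Lemma so_orthTl A B : U A -> V B -> orth (shift D A) B.
Proof. by move=> /(so_shiftU so); exact: (so_orth so). Qed.

Lemma so_trunc_uniq A E B A' B' : is_ext A E B -> is_ext A' E B' ->
  U A -> V B -> U A' -> V B' -> iso A A' /\ iso B B'.
Proof.
move=> AEB AEB' UA VB UA' VB'; apply: (trunc_uniq AEB AEB');
by [exact: (so_orth so)|exact: so_orthTl].
Qed.

Lemma so_grid E' E E'' A' B' A'' B'' : is_ext E' E E'' ->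
  is_ext A' E' B' -> is_ext A'' E'' B'' -> U A' -> V B' -> U A'' -> V B'' ->
  exists A B, [/\ is_ext A E B, is_ext A' A A'', is_ext B' B B'', U A & V B].
Proof.
move=> E3 E1 E2 UA' VB' UA'' VB''.
have [A [B [AEB AAA BBB]]] := is_ext_grid E3 E1 E2 (so_orthT UA'' VB').
exists A, B; split=> //; first exact: (so_extU so) AAA UA' UA''.
exact: (so_extV so) BBB VB' VB''.
Qed.

(** The grid yields triangles on some truncation of [E]; uniqueness carries them to the given
    one. *)
Lemma so_trunc_ext E' E E'' A' B' A B A'' B'' : is_ext E' E E'' ->
  is_ext A' E' B' -> is_ext A E B -> is_ext A'' E'' B'' ->
  U A' -> V B' -> U A -> V B -> U A'' -> V B'' ->
  is_ext A' A A'' /\ is_ext B' B B''.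
Proof.
move=> E3 E1 E0 E2 UA' VB' UA VB UA'' VB''.
have [A1 [B1 [AEB AAA BBB UA1 VB1]]] := so_grid E3 E1 E2 UA' VB' UA'' VB''.
have [AA BB] := so_trunc_uniq AEB E0 UA1 VB1 UA VB.
split; first exact: is_ext_iso (iso_refl _) AA (iso_refl _) AAA.
exact: is_ext_iso (iso_refl _) BB (iso_refl _) BBB.
Qed.

(** [P] and [Q] carry extra information on the two parts, such as a single level or a range of
    phases, through the induction. *)
Lemma so_trunc_closure (S P Q : set D) :
  (forall E, S E -> exists A B, [/\ is_ext A E B, U A, V B,
     ext_closure P A & ext_closure Q B]) ->
  (exists2 A, U A & is_zero A) -> (exists2 B, V B & is_zero B) ->
  forall E, ext_closure S E -> exists A B, [/\ is_ext A E B, U A, V B,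
     ext_closure P A & ext_closure Q B].
Proof.
move=> truncS [A0 UA0 A00] [B0 VB0 B00].
apply: ext_closure_ind_sub => [//|E E0|E' E E''].
  exists A0, B0; split=> //; try exact: Ext_zero.
  apply: is_ext_iso (is_ext_id0 E B00); try exact: iso_refl.
  exact: zero_iso.
move=> E3 [A' [B' [E1 UA' VB' PA' QB']]] [A'' [B'' [E2 UA'' VB'' PA'' QB'']]].
have [A [B [AEB AAA BBB UA VB]]] := so_grid E3 E1 E2 UA' VB' UA'' VB''.
exists A, B; split=> //; first exact: Ext_ext AAA PA' PA''.
exact: Ext_ext BBB QB' QB''.
Qed.

(** The cone of the composite [F -> E -> B] lies in both [U] and [V]. *)
Lemma so_split A E B F G (a : hom A E) (b : hom E B) (c : hom B (shift D A)) :
  dist a b c -> U A -> V B -> is_ext F E G -> V F -> U G -> c = 0.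
Proof.
move=> abc UA VB [f [g [h fgh]]] VF UG.
have [W [w [w' bfw]]] := cone_exists (b ∘ f).
have [u [v [uvW _ _ _ _]]] := tr4 (triP D) fgh (dist_rot abc) bfw.
have UW : U W.
  by apply: (so_extU so) (is_extP uvW) UG _; exact: (so_shiftU so A).1.
have VW : V W.
  move/is_extP/is_ext_rot: bfw => BWF; apply: (so_extV so) BWF VB _.
  exact: (so_shiftV so F).1.
have W0 : is_zero W by apply: (so_orth so) UW VW _.
have [r br] : exists r, idm B = b ∘ f ∘ r.
  by apply: (dist_lift (u := idm B) bfw); exact: zero_homr.
by rewrite -[c]comp_idr br !comp_assoc (dist_comp0' abc) !comp0l.
Qed.

(** [u] factors through [a] because [U] has no maps to [F], and [q ∘ a] vanishes; thus [a] has the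
    retraction [t ∘ r], which kills the connecting map. *)
Lemma so_retract_split E A B (u : hom A E) (r : hom E A) (v : hom B E)
    (q : hom E B) : U A -> V B -> u ∘ r + v ∘ q = idm E ->
  (exists C F, [/\ is_ext C E F, U C & V F]) ->
  exists C F, [/\ is_dsum C F E, U C & V F].
Proof.
move=> UA VB e [C [F [[a [b [c abc]]] UC VF]]].
have [t def_u] := dist_lift abc (so_orth so UA VF (b ∘ u)).
have qa := so_orth so UC VB (q ∘ a).
have a_mono x : a ∘ x = a -> x = idm C.
  move=> ax; apply/(@fmap_inj _ _ (shift D))/eqP; rewrite -subr_eq0 -fmapN -fmapD.
  have [|y ->] := dist_lift2 (u := x - idm C) abc.
    by rewrite compBr ax comp_idr subrr.
  by rewrite (so_orthTl UC VF y) comp0r.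
have tra : t ∘ r ∘ a = idm C.
  apply: a_mono; rewrite !comp_assoc -def_u -[RHS]comp_idl -e compDl.
  by rewrite -(comp_assoc v) qa comp0r addr0.
have c0 : c = 0.
  have := dist_comp0' (dist_rot abc); rewrite compNl => /eqP.
  rewrite oppr_eq0 => /eqP ac.
  by rewrite -[c]comp_idl -fmap_id -tra fmap_comp -comp_assoc ac comp0r.
exists C, F; split=> //.
by rewrite c0 in abc; have [j [p ?]] := dist_split abc; exists a, j, p, b.
Qed.

End Pair.

End Truncation.

Section Levels.
Variables (k : fieldType) (D : triCategory k) (X : autoequiv D).
Hypothesis X_exact : exact_functor X.
Variable (H : set D).
Hypothesis hH : baric_heart X H.
Implicit Types (A B E : D) (l m : int).

Definition level l : set D := ess_im (xpow X l) H.

Lemma heart_iso A B : iso A B -> H A -> H B.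
Proof. by have [[isoH _ _] _ _] := baric_sub hH; exact: isoH. Qed.

Lemma heart_shift A : H A <-> H (shift D A).
Proof. exact: (sub_shift (baric_sub hH)). Qed.

Lemma heart_ext A E B : is_ext A E B -> H A -> H B -> H E.
Proof.
move=> /is_ext_rot/is_ext_rot/(sub_cone (baric_sub hH)) BAE HA HB.
by apply: (heart_shift E).2; apply: BAE => //; exact: (heart_shift A).1.
Qed.

Lemma heart_zero A : is_zero A -> H A.
Proof.
have [[_ [Z Z0 HZ] _] _ _] := baric_sub hH => A0.
exact: heart_iso (zero_iso Z0 A0) HZ.
Qed.

Lemma levelE l E : level l E <-> H (xpow X (- l) E).
Proof.
split=> [[A HA AE]|HE]; last by exists (xpow X (- l) E) => //; exact: xpowK.
apply: heart_iso HA; apply: iso_trans (iso_sym (xpowVK X l A)) _.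
exact: xpow_iso.
Qed.

Lemma level_xpow l E : H E -> level l (xpow X l E).
Proof. by move=> HE; exists E => //; exact: iso_refl. Qed.

Lemma level0 E : level 0 E <-> H E.
Proof. by rewrite levelE. Qed.

Lemma level_iso l A B : iso A B -> level l A -> level l B.
Proof. by rewrite !levelE => /(xpow_iso X (- l)); exact: heart_iso. Qed.

Lemma level_ext l A E B : is_ext A E B -> level l A -> level l B -> level l E.
Proof. by rewrite !levelE => /(xpow_ext X_exact (- l)); exact: heart_ext. Qed.

Lemma level_zero l A : is_zero A -> level l A.
Proof. by move=> A0; apply/levelE/heart_zero/xpow_zero. Qed.

Lemma level_shift l A : level l A <-> level l (shift D A).
Proof.
rewrite !levelE heart_shift; split; apply: heart_iso.
  exact/iso_sym/(xpow_shift X_exact).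
exact/(xpow_shift X_exact).
Qed.

Lemma level_succ l A : level l A <-> level (l + 1) (X A).
Proof.
have e : iso (xpow X (- (l + 1)) (X A)) (xpow X (- l) A).
  by apply: iso_trans (iso_sym (xpow_succ X _ _)) _; rewrite opprD addrNK;
     exact: iso_refl.
by rewrite !levelE; split; apply: heart_iso => //; exact: iso_sym.
Qed.

Lemma level_orth l m A B : m < l -> level l A -> level m B -> orth A B.
Proof. by move=> ml lA mB f; apply: (baric_hom hH ml) lA mB. Qed.

Definition level_ge m := ext_closure (fun E => exists2 l, m <= l & level l E).
Definition level_lt m := ext_closure (fun E => exists2 l, l < m & level l E).

Lemma level_semiorthogonal m : semiorthogonal (level_ge m) (level_lt m).
Proof.
split=> [||||].
- apply: ext_closure_orth => A B [l ml lA] [l' lm lB].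
  exact: level_orth (lt_le_trans lm ml) lA lB.
- apply: ext_closure_stable => [|A B AB [l ml lA]|A].
  + exact: shift_exact.
  + by exists l => //; exact: level_iso AB lA.
  + by split=> -[l ml lA]; exists l => //; move: lA; rewrite -level_shift.
- apply: ext_closure_stable => [|A B AB [l ml lA]|A].
  + exact: shift_exact.
  + by exists l => //; exact: level_iso AB lA.
  + by split=> -[l ml lA]; exists l => //; move: lA; rewrite -level_shift.
- by move=> A E B; exact: Ext_ext.
- by move=> A E B; exact: Ext_ext.
Qed.

Lemma level_ge_gen m l E : m <= l -> level l E -> level_ge m E.
Proof. by move=> ml lE; apply: Ext_gen; exists l. Qed.

Lemma level_lt_gen m l E : l < m -> level l E -> level_lt m E.
Proof. by move=> ml lE; apply: Ext_gen; exists l. Qed.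

Lemma ext_closure_level E : ext_closure (fun A => exists l, level l A) E.
Proof.
have [E0|/(baric_filtration hH)[t _ tE]] := pselect (is_zero E).
  exact: Ext_zero.
by apply: (filtered_ext_closure tE) => l A _ lA; exists l.
Qed.

Lemma level_trunc m E :
  exists A B, [/\ is_ext A E B, level_ge m A & level_lt m B].
Proof.
have [Z Z0] := tr_zero (triP D).
have [||| A [B [AEB mA mB _ _]]] := so_trunc_closure (level_semiorthogonal m)
    (P := setT) (Q := setT) _ _ _ (ext_closure_level E).
- move=> {}E [l lE]; have [ml|lm] := leP m l.
    exists E, Z; split; try exact: Ext_gen; try exact: Ext_zero.
      exact: is_ext_id0.
    exact: level_ge_gen lE.
  exists Z, E; split; try exact: Ext_gen; try exact: Ext_zero.
    exact: is_ext_0id.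
  exact: level_lt_gen lE.
- by exists Z => //; exact: Ext_zero.
- by exists Z => //; exact: Ext_zero.
by exists A, B.
Qed.

Lemma level_ge_trunc l E : level_ge l E ->
  exists U A, [/\ is_ext U E A, level_ge (l + 1) U & level l A].
Proof.
have [Z Z0] := tr_zero (triP D) => lE.
have [||| U [A [UEA lU _ _ QA]]] := so_trunc_closure
    (level_semiorthogonal (l + 1)) (P := setT) (Q := level l) _ _ _ lE.
- move=> {}E {lE} [m lm mE]; have [lm'|ml] := ltP l m.
    exists E, Z; split; try exact: Ext_gen; try exact: Ext_zero.
      exact: is_ext_id0.
    by apply: level_ge_gen mE; lia.
  have -> : l = m by lia.
  exists Z, E; split; try exact: Ext_gen; try exact: Ext_zero.
    exact: is_ext_0id.
  by apply: level_lt_gen mE; lia.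
- by exists Z => //; exact: Ext_zero.
- by exists Z => //; exact: Ext_zero.
exists U, A; split=> //; move: A QA {UEA}.
apply: ext_closure_ind_sub => // [A A0|A E' B]; first exact: level_zero.
exact: level_ext.
Qed.

(** * Graded pieces and coefficients in the Grothendieck group *)

Notation heartH := (heart hH).

Lemma heart_is_ext (A E B : heartH) :
  is_ext A E B <-> is_ext (heart_ob A) (heart_ob E) (heart_ob B).
Proof. by []. Qed.

(** A relation, because truncation triangles involve choices; only the class of [B] is shown to be
    determined. *)
Definition graded_piece l E (B : heartH) : Prop :=
  exists E1 V U A,
    [/\ is_ext E1 E V, level_ge l E1 & level_lt l V] /\
    [/\ is_ext U E1 A, level_ge (l + 1) U, level l A
      & iso (xpow X l (heart_ob B)) A].

Lemma graded_piece_exists l E : exists B : heartH, graded_piece l E B.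
Proof.
have [E1 [V [E1EV lE1 lV]]] := level_trunc l E.
have [U [A [UE1A lU lA]]] := level_ge_trunc lE1.
have HA := (levelE l A).1 lA.
exists (exist _ _ HA : heartH), E1, V, U, A.
by split=> //; split=> //; exact: xpowK.
Qed.

Lemma graded_piece_ext l E' E E'' (B' B B'' : heartH) : is_ext E' E E'' ->
  graded_piece l E' B' -> graded_piece l E B -> graded_piece l E'' B'' ->
  cls B = cls B' + cls B''.
Proof.
move=> E3 [E1' [V' [U' [A' [[E1V' lE1' lV'] [UE1' lU' lA' BA']]]]]].
move=> [E1 [V [U [A [[E1V lE1 lV] [UE1 lU lA BA]]]]]].
move=> [E1'' [V'' [U'' [A'' [[E1V'' lE1'' lV''] [UE1'' lU'' lA'' BA'']]]]]].
have [E13 _] := so_trunc_ext (level_semiorthogonal l) E3 E1V' E1V E1V''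
  lE1' lV' lE1 lV lE1'' lV''.
(* Level [l] is below [l + 1], so the triangle that defines the graded piece is itself a truncation
   triangle. *)
have lt_gen A0 : level l A0 -> level_lt (l + 1) A0.
  by apply: level_lt_gen; lia.
have [_ A3] := so_trunc_ext (level_semiorthogonal (l + 1)) E13 UE1' UE1 UE1''
  lU' (lt_gen _ lA') lU (lt_gen _ lA) lU'' (lt_gen _ lA'').
apply/cls_ext/heart_is_ext/(xpow_ext X_exact l).
by apply: is_ext_iso A3; exact: iso_sym.
Qed.

(** Independence of choices is additivity along [E -> E -> 0]; additivity along [0 -> 0 -> 0] first
    shows that the piece of a zero object has class zero. *)
Lemma graded_piece_uniq l E (B B' : heartH) : graded_piece l E B -> graded_piece l E B' ->
  cls B = cls B'.
Proof.
have [Z Z0] := tr_zero (triP D) => EB EB'.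
have [C ZC] := graded_piece_exists l Z.
have /eqP := graded_piece_ext (is_ext_id0 Z Z0) ZC ZC ZC.
rewrite -subr_eq subrr eq_sym => /eqP C0.
by rewrite (graded_piece_ext (is_ext_id0 E Z0) EB' EB ZC) C0 addr0.
Qed.

Lemma graded_piece_level l m (B : heartH) : exists2 C,
  graded_piece m (xpow X l (heart_ob B)) C & cls C = if m == l then cls B else 0.
Proof.
have [Z Z0] := tr_zero (triP D); set E := xpow X l _.
have lE : level l E by apply: level_xpow; exact: svalP B.
pose ZH : heartH := exist _ Z (heart_zero Z0).
have ZH0 : cls ZH = 0 by exact: cls_zero.
have isoZ : iso (xpow X m (heart_ob ZH)) Z.
  by apply: zero_iso => //; apply/xpow_zero.
have [ml|lm|e] := ltgtP m l.
- exists ZH => //; exists E, Z, E, Z; split; split=> //; try exact: is_ext_id0;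
  try exact: Ext_zero; try exact: level_zero; apply: level_ge_gen lE; lia.
- exists ZH => //; exists Z, E, Z, Z; split; split=> //; try exact: is_ext_0id;
  try exact: Ext_zero; try exact: level_zero; apply: level_lt_gen lE; lia.
exists B => //; rewrite e; exists E, Z, Z, E; split; split=> //;
  try exact: is_ext_id0; try exact: is_ext_0id;
  try exact: Ext_zero; try exact: iso_refl; apply: level_ge_gen lE; lia.
Qed.

(** The coefficient of [q^l] under the inverse of [heart_tensor]. *)
Definition coef l : K0 D -> K0 heartH :=
  K0lift (fun E => cls (sval (cid (graded_piece_exists l E)))).

Lemma coef_additive l :
  additive_on_triangles (fun E => cls (sval (cid (graded_piece_exists l E)))).
Proof. by move=> A E B /graded_piece_ext; apply; exact: svalP. Qed.

Lemma coef_morph l : zmod_morphism (coef l).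
Proof. exact/K0lift_is_zmod_morphism/coef_additive. Qed.

Lemma coef_cls l E (B : heartH) : graded_piece l E B -> coef l (cls E) = cls B.
Proof.
rewrite /coef K0lift_cls; last exact: coef_additive.
by apply: graded_piece_uniq; exact: svalP.
Qed.

Notation incl := (@heart_incl k D X H hH).

Lemma heart_incl_additive :
  additive_on_triangles (fun A : heartH => cls (heart_ob A)).
Proof. by move=> A E B /heart_is_ext/cls_ext. Qed.

Lemma heart_incl_morph : zmod_morphism incl.
Proof. exact/K0lift_is_zmod_morphism/heart_incl_additive. Qed.

Lemma heart_incl_cls (B : heartH) : incl (cls B) = cls (heart_ob B).
Proof. exact/K0lift_cls/heart_incl_additive. Qed.

Lemma qact_incl_cls l (B : heartH) :
  qact X l (incl (cls B)) = cls (xpow X l (heart_ob B)).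
Proof. by rewrite heart_incl_cls qact_cls. Qed.

Lemma coef_qact l m x : coef m (qact X l (incl x)) = if m == l then x else 0.
Proof.
have qM := qact_morph X_exact l; have cM := coef_morph m.
have iM := heart_incl_morph.
elim/K0_ind: x => [|x y IHx IHy|B].
- by rewrite (zmod_morph0 iM) (zmod_morph0 qM) (zmod_morph0 cM) if_same.
- by rewrite iM qM cM IHx IHy; case: eqP => // _; rewrite subr0.
rewrite qact_incl_cls; have [C mC <-] := graded_piece_level l m B.
exact: coef_cls.
Qed.

Definition zrange N : seq int := [seq i%:Z - N%:Z | i <- index_iota 0 N.*2.+1].

Lemma zrange_uniq N : uniq (zrange N).
Proof. by rewrite map_inj_uniq ?iota_uniq// => i j; lia. Qed.

Lemma mem_zrange N l : (l \in zrange N) = (`|l| <= N)%N.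
Proof.
apply/mapP/idP => [|lN]; first by case=> i; rewrite mem_index_iota => ? ->; lia.
by exists (absz (l + N%:Z)); rewrite ?mem_index_iota; lia.
Qed.

Lemma big_zrange (V : zmodType) N (F : int -> V) :
  \sum_(l <- zrange N) F l = \sum_(i < N.*2.+1) F (i%:Z - N%:Z).
Proof. by rewrite big_map big_mkord. Qed.

(** The expansion holds for all large [N], so that the inductive steps can use a common range for
    two elements. *)
Lemma K0_expand x : exists N0, forall N, (N0 <= N)%N ->
  x = \sum_(l <- zrange N) qact X l (incl (coef l x)) /\
  (forall l, (N < `|l|)%N -> coef l x = 0).
Proof.
have qM l := qact_morph X_exact l; have cM := coef_morph.
have iM := heart_incl_morph.
have P0 : exists N0, forall N, (N0 <= N)%N ->
  0 = \sum_(l <- zrange N) qact X l (incl (coef l 0)) /\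
  (forall l, (N < `|l|)%N -> coef l 0 = 0).
  exists 0%N => N _; split=> [|l _]; last exact: zmod_morph0.
  rewrite big1 // => l _.
  by rewrite (zmod_morph0 (cM l)) (zmod_morph0 iM) (zmod_morph0 (qM l)).
elim/K0_ind: x => // [x y [Nx Px] [Ny Py]|E].
  exists (maxn Nx Ny) => N; rewrite geq_max => /andP[/Px[ex cx] /Py[ey cy]].
  split=> [|l lN]; last by rewrite cM cx// cy// subrr.
  by rewrite {1}ex {1}ey -sumrB; apply: eq_bigr => l _; rewrite cM iM qM.
move: E (ext_closure_level E).
apply: ext_closure_ind_sub => [E [l [A HA AE]]|E /cls_zero ->//|A E B].
  pose B : heartH := exist _ A HA.
  have eE : cls E = qact X l (incl (cls B)).
    by rewrite qact_incl_cls; exact/esym/cls_iso.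
  exists `|l|%N => N lN; split=> [|m mN]; rewrite eE; last first.
    by rewrite coef_qact; case: eqP => // ml; lia.
  rewrite (bigD1_seq l) ?zrange_uniq ?mem_zrange//= big1 ?addr0 => [|m ml].
    by rewrite coef_qact eqxx.
  by rewrite coef_qact (negbTE ml) (zmod_morph0 iM) (zmod_morph0 (qM m)).
move=> /cls_ext -> [Nx Px] [Ny Py].
exists (maxn Nx Ny) => N; rewrite geq_max => /andP[/Px[ex cx] /Py[ey cy]].
split=> [|l lN]; last by rewrite (zmod_morphD (cM l)) cx// cy// addr0.
rewrite {1}ex {1}ey -big_split; apply: eq_bigr => l _ /=.
by rewrite (zmod_morphD (cM l)) (zmod_morphD iM) (zmod_morphD (qM l)).
Qed.

Lemma K0_morph_ext (G : zmodType) (f g : K0 D -> G) : zmod_morphism f ->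
  zmod_morphism g ->
  (forall l x, f (qact X l (incl x)) = g (qact X l (incl x))) -> f =1 g.
Proof.
move=> fM gM fg x; have [N /(_ N (leqnn N))[-> _]] := K0_expand x.
by rewrite (zmod_morph_sum fM) (zmod_morph_sum gM); apply: eq_bigr.
Qed.

Lemma laurent_sumE (A V : zmodType) (act : int -> A -> V) (u : laurent A) N :
  (forall l, act l 0 = 0) -> (forall l, (N < `|l|)%N -> u l = 0) ->
  laurent_sum act u = \sum_(l <- zrange N) act l (u l).
Proof.
move=> act0 uN; rewrite /laurent_sum.
rewrite [RHS](bigID (mem (finsupp u))) /= [X in _ + X]big1 ?addr0; last first.
  by move=> l; rewrite memNfinsupp => /eqP ->.
rewrite -[RHS]big_filter; apply: perm_big; apply: uniq_perm.
- exact: fset_uniq.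
- by rewrite filter_uniq// zrange_uniq.
move=> l; rewrite mem_filter mem_zrange; case: (boolP (l \in finsupp u)) => //.
by rewrite mem_finsupp => ul /=; apply/esym; rewrite leqNgt; apply/negP => /uN/eqP;
  rewrite (negbTE ul).
Qed.

Lemma laurent_bound (A : zmodType) (u : laurent A) :
  exists N, forall l, (N < `|l|)%N -> u l = 0.
Proof.
exists (\max_(l <- finsupp u) `|l|%N) => l lN; apply/eqP.
rewrite -memNfinsupp; apply/negP => lu.
by move: lN; rewrite ltnNge (@leq_bigmax_seq _ _ xpredT absz _ lu).
Qed.

Lemma coef_tensor l (u : laurent (K0 heartH)) : coef l (heart_tensor u) = u l.
Proof.
have [N0 uN0] := laurent_bound u.
have uN m : (maxn N0 `|l| < `|m|)%N -> u m = 0 by move=> ?; apply: uN0; lia.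
rewrite /heart_tensor (laurent_sumE _ uN) => [|m]; last first.
  by rewrite (zmod_morph0 heart_incl_morph) (zmod_morph0 (qact_morph X_exact m)).
rewrite (zmod_morph_sum (coef_morph l)) (bigD1_seq l) ?zrange_uniq ?mem_zrange//=.
  rewrite big1 ?addr0 => [|m ml]; first by rewrite coef_qact eqxx.
  by rewrite coef_qact eq_sym (negbTE ml).
lia.
Qed.

Lemma laurent_exists (A : zmodType) (f : int -> A) N :
  (forall l, (N < `|l|)%N -> f l = 0) ->
  exists u : laurent A, forall l, u l = f l.
Proof.
move=> fN; exists [fsfun l in seq_fset tt (zrange N) => f l | 0] => l.
rewrite fsfunE; case: ifPn => // lS; apply/esym/fN.
by rewrite ltnNge -mem_zrange; apply: contra lS; rewrite seq_fsetE.
Qed.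

Lemma heart_tensor_surj x :
  exists2 u : laurent (K0 heartH), heart_tensor u = x & forall l, u l = coef l x.
Proof.
have [N /(_ N (leqnn N))[ex cx]] := K0_expand x.
have [u uE] := laurent_exists cx.
exists u => //; rewrite /heart_tensor (laurent_sumE (N := N)) => [|l|l lN].
- by rewrite [RHS]ex; apply: eq_bigr => l _; rewrite uE.
- by rewrite (zmod_morph0 heart_incl_morph) (zmod_morph0 (qact_morph X_exact l)).
- by rewrite uE cx.
Qed.

Lemma heart_tensor_bij : bijective (@heart_tensor k D X H hH).
Proof.
have surj x : exists u : laurent (K0 heartH), heart_tensor u = x.
  by have [u ux _] := heart_tensor_surj x; exists u.
exists (fun x => sval (cid (surj x))) => [u|x]; last exact: svalP (cid (surj x)).
apply/fsfunP => l; rewrite -[RHS]coef_tensor -[LHS]coef_tensor.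
by rewrite (svalP (cid (surj _))).
Qed.

Lemma heart_incl_inj : injective incl.
Proof.
move=> x y xy; have := coef_qact 0 0 x; rewrite eqxx => <-.
by rewrite xy coef_qact eqxx.
Qed.

(** * Homomorphisms prescribed level by level, and the rank *)

Section TensorLift.
Variables (V : zmodType) (act : int -> K0 heartH -> V).
Hypothesis act_morph : forall l, zmod_morphism (act l).

(** [induced_charge] is the instance with [act l] given by [expipi (s *~ l)] times the charge of the
    heart; an [act] independent of [l] amounts to setting [q = 1]. *)
Definition tensor_lift (x : K0 D) : V :=
  laurent_sum act (xget [fsfun] (@heart_tensor k D X H hH @^-1` [set x])).

Lemma tensor_liftE x N : (forall l, (N < `|l|)%N -> coef l x = 0) ->
  tensor_lift x = \sum_(l <- zrange N) act l (coef l x).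
Proof.
move=> xN; have [u ux uE] := heart_tensor_surj x.
rewrite /tensor_lift; set v := xget _ _.
have vx : heart_tensor v = x.
  suff : (@heart_tensor k D X H hH @^-1` [set x]) v by [].
  by apply: xgetPex; exists u.
have vE l : v l = coef l x by rewrite -vx coef_tensor.
rewrite (laurent_sumE (N := N)) => [|l|l lN]; last by rewrite vE xN.
  by apply: eq_bigr => l _; rewrite vE.
exact: zmod_morph0.
Qed.

Lemma tensor_lift_morph : zmod_morphism tensor_lift.
Proof.
move=> x y.
have [Nx /(_ _ (leq_maxl Nx _))Px] := K0_expand x.
have [Ny /(_ _ (leq_maxr _ Ny))Py] := K0_expand y.
have [[_ cx] [_ cy]] := (Px Ny, Py Nx).
rewrite (tensor_liftE cx) (tensor_liftE cy) (tensor_liftE (N := maxn Nx Ny)).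
  by rewrite -sumrB; apply: eq_bigr => l _; rewrite coef_morph act_morph.
by move=> l lN; rewrite coef_morph cx// cy// subrr.
Qed.

Lemma tensor_lift_qact l a : tensor_lift (qact X l (incl a)) = act l a.
Proof.
rewrite (tensor_liftE (N := `|l|%N)) => [|m ml].
  rewrite (bigD1_seq l) ?zrange_uniq ?mem_zrange//= big1 ?addr0 => [|m ml].
    by rewrite coef_qact eqxx.
  by rewrite coef_qact (negbTE ml) (zmod_morph0 (act_morph m)).
by rewrite coef_qact; case: eqP => // e; lia.
Qed.

End TensorLift.

(** The first clause says that the [q^l b_j] generate [K0 D] as far as
    integral functionals can see, the second that they have a dual basis up to
    the action of [q]. *)
Definition dualizable n (b : 'I_n -> K0 D) : Prop :=
  (forall f g : K0 D -> int, zmod_morphism f -> zmod_morphism g ->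
     (forall l j, f (qact X l (b j)) = g (qact X l (b j))) -> f =1 g) /\
  exists phi : 'I_n -> K0 D -> int, (forall i, zmod_morphism (phi i)) /\
    forall i l j, phi i (qact X l (b j)) = (i == j)%:Z.

(** Rank comparison at [q = 1]. The functionals [phi i] are invariant under [q], hence are
    combinations of the [psi j]; evaluating on [b] makes the two pairing matrices multiply to the
    identity of size [m]. *)
Lemma dualizable_leq (m n : nat) (b : 'I_m -> K0 D) (c : 'I_n -> K0 D) :
  dualizable b -> dualizable c -> (m <= n)%N.
Proof.
move=> [b_span [phi [phiM phib]]] [c_span [psi [psiM psic]]].
have phi_inv i l x : phi i (qact X l x) = phi i x.
  apply: (b_span (fun x => phi i (qact X l x))) => // [y z|l' j].
    by rewrite (qact_morph X_exact) phiM.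
  by rewrite -qactD // !phib.
pose A : 'M[int]_(m, n) := \matrix_(i, j) phi i (c j).
pose B : 'M[int]_(n, m) := \matrix_(j, i) psi j (b i).
have phiE i : phi i =1 fun x => \sum_j A i j * psi j x.
  apply: c_span => // [x y|l j].
    by rewrite -sumrB; apply: eq_bigr => j _; rewrite psiM mulrBr.
  rewrite (bigD1 j) //= psic eqxx mulr1 big1 ?addr0 ?phi_inv ?mxE// => j' jj'.
  by rewrite psic (negbTE jj') mulr0.
apply: (@mulmx1_min _ m n A B); apply/matrixP => i j.
rewrite !mxE (_ : _%:R = (i == j)%:Z); last by case: (i == j).
rewrite -(phib i 0 j) qact0// phiE; apply: eq_bigr => l _.
by rewrite [B _ _]mxE.
Qed.

Lemma Zbasis_dual (A : zmodType) n (b : 'I_n -> A) : is_Zbasis b ->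
  exists chi : 'I_n -> A -> int, [/\ forall i, zmod_morphism (chi i),
    forall i j, chi i (b j) = (i == j)%:Z
  & forall x, x = \sum_i b i *~ chi i x].
Proof.
case=> g gK Kg; exists (fun i x => g x 0 i).
have combB c d : int_comb b (c - d) = int_comb b c - int_comb b d.
  by rewrite /int_comb -sumrB; apply: eq_bigr => i _; rewrite !mxE mulrzBr.
split=> [i x y|i j|x]; last by rewrite -[LHS]Kg.
- by rewrite -{1}[x]Kg -{1}[y]Kg -combB gK !mxE.
have -> : b j = int_comb b (delta_mx 0 j).
  rewrite /int_comb (bigD1 j) //= mxE !eqxx big1 ?addr0// => l lj.
  by rewrite mxE (negbTE lj) andbF.
by rewrite gK mxE eqxx; case: (i == j).
Qed.

Lemma heart_dualizable n (b : 'I_n -> K0 heartH) : is_Zbasis b ->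
  dualizable (fun i => incl (b i)).
Proof.
move=> /Zbasis_dual[chi [chiM chib chiE]]; split=> [f g fM gM fg|].
  apply: K0_morph_ext => // l x.
  have qM := qact_morph X_exact l; have iM := heart_incl_morph.
  rewrite (chiE x) (zmod_morph_sum iM) (zmod_morph_sum qM).
  rewrite (zmod_morph_sum fM) (zmod_morph_sum gM); apply: eq_bigr => i _.
  by rewrite (zmod_morphMz iM) (zmod_morphMz qM) (zmod_morphMz fM)
    (zmod_morphMz gM) fg.
exists (fun i => tensor_lift (fun _ => chi i)); split=> [i|i l j].
  by apply: tensor_lift_morph => _; exact: chiM.
by rewrite tensor_lift_qact.
Qed.

Lemma free_dualizable n : K0_free X n ->
  exists b : 'I_n -> K0 D, dualizable b.
Proof.
case=> b [g gK Kg]; exists b.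
pose F (p : {ffun 'I_n -> laurent int}) :=
  \sum_(i < n) laurent_sum (fun l m => qact X l (b i) *~ m) (p i).
have {}Kg x : F (g x) = x by exact: Kg.
have {}gK p : g (F p) = p by exact: gK.
have bound (p : {ffun 'I_n -> laurent int}) :
    exists N, forall i l, (N < `|l|)%N -> p i l = 0.
  have /fin_all_exists[N pN] i := laurent_bound (p i).
  exists (\max_i N i) => i l lN; apply: pN; apply: leq_ltn_trans lN.
  exact: leq_bigmax.
have FE (p : {ffun 'I_n -> laurent int}) N : (forall i l, (N < `|l|)%N -> p i l = 0) ->
    F p = \sum_i \sum_(l <- zrange N) qact X l (b i) *~ p i l.
  move=> pN; apply: eq_bigr => i _; apply: laurent_sumE => [l|]; last exact: pN.
  by rewrite mulr0z.
have mk (f : 'I_n -> int -> int) N : (forall i l, (N < `|l|)%N -> f i l = 0) ->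
    exists p : {ffun 'I_n -> laurent int}, forall i l, p i l = f i l.
  move=> fN; have /fin_all_exists[p pE] i := laurent_exists (fN i).
  by exists (finfun p) => i l; rewrite ffunE.
split=> [f h fM hM fh x|].
  have [N gN] := bound (g x); rewrite -[x]Kg (FE _ _ gN).
  rewrite (zmod_morph_sum fM) (zmod_morph_sum hM); apply: eq_bigr => i _.
  rewrite (zmod_morph_sum fM) (zmod_morph_sum hM); apply: eq_bigr => l _.
  by rewrite (zmod_morphMz fM) (zmod_morphMz hM) fh.
(* The [i]-th coordinate evaluated at [q = 1]. *)
pose phi i x : int := laurent_sum (fun _ m => m) (g x i).
have phiE i x N : (forall i l, (N < `|l|)%N -> g x i l = 0) ->
    phi i x = \sum_(l <- zrange N) g x i l.
  by move=> gN; apply: laurent_sumE => // l; exact: gN.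
exists phi; split=> [i x y|i l j].
  have [Nx xN] := bound (g x); have [Ny yN] := bound (g y).
  pose N := maxn Nx Ny.
  have {}xN j l : (N < `|l|)%N -> g x j l = 0 by move=> lN; apply: xN; lia.
  have {}yN j l : (N < `|l|)%N -> g y j l = 0 by move=> lN; apply: yN; lia.
  have [|p pE] := mk (fun j l => g x j l - g y j l) N.
    by move=> j l lN; rewrite xN// yN// subrr.
  have pN j l : (N < `|l|)%N -> p j l = 0.
    by move=> lN; rewrite pE xN// yN// subrr.
  (* The inverse [g] is given as a map of sets; its additivity is recovered from the uniqueness of
     coordinates. *)
  have e : g (x - y) = p.
    rewrite -[RHS]gK; congr (g _); rewrite -{1}[x]Kg -{1}[y]Kg.
    rewrite (FE _ _ xN) (FE _ _ yN) (FE _ _ pN) -sumrB; apply: eq_bigr => j _.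
    by rewrite -sumrB; apply: eq_bigr => l _; rewrite pE mulrzBr.
  rewrite (phiE _ _ _ xN) (phiE _ _ _ yN) (phiE _ _ N) ?e//.
  by rewrite -sumrB; apply: eq_bigr => l _; rewrite pE.
have [|p pE] := mk (fun i m => ((i == j) && (m == l))%:Z) `|l|%N.
  by move=> i' m lm; case: (m =P l) => [e|]; rewrite ?andbF//; lia.
have pN i' m : (`|l| < `|m|)%N -> p i' m = 0.
  by move=> lm; rewrite pE; case: (m =P l) => [e|]; rewrite ?andbF//; lia.
have e : g (qact X l (b j)) = p.
  rewrite -[RHS]gK; congr (g _); rewrite (FE _ _ pN).
  rewrite (bigD1 j) //= [X in _ + X]big1 ?addr0 => [|i' ij]; last first.
    by apply: big1 => m _; rewrite pE (negbTE ij) mulr0z.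
  rewrite (bigD1_seq l) ?zrange_uniq ?mem_zrange//= big1 ?addr0 => [|m ml].
    by rewrite pE !eqxx mulr1z.
  by rewrite pE (negbTE ml) andbF mulr0z.
rewrite (phiE _ _ `|l|%N) ?e//.
rewrite (bigD1_seq l) ?zrange_uniq ?mem_zrange//= big1 ?addr0 => [|m ml].
  by rewrite pE eqxx andbT.
by rewrite pE (negbTE ml) andbF.
Qed.

(** Converts the basis of unknown length [m] from the support property into one of the length [n]
    that the lattice of [q_support] must have. *)
Lemma heart_Zbasis (m n : nat) (b : 'I_m -> K0 heartH) : is_Zbasis b -> K0_free X n ->
  exists b' : 'I_n -> K0 heartH, is_Zbasis b'.
Proof.
move=> bP /free_dualizable[c cP]; have bD := heart_dualizable bP.
have e : m = n.
  by apply/eqP; rewrite eqn_leq (dualizable_leq bD cP) (dualizable_leq cP bD).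
by subst n; exists b.
Qed.

End Levels.

(** * Stability conditions *)

Lemma sorted_gt_rcons disp (I : porderType disp) (t : seq I) i :
  sorted >%O (rcons t i) = sorted >%O t && all (fun x => i < x)%O t.
Proof.
have gt_trans : transitive (>%O : rel I).
  by move=> y x z /= yx zy; exact: lt_trans zy yx.
by rewrite !(sorted_pairwise gt_trans) pairwise_rcons andbC.
Qed.

Lemma filtered_orthl (k : fieldType) (D : triCategory k) (I : eqType)
    (P : I -> set D) t E W : filtered P t E ->
  (forall i A, i \in t -> P i A -> orth A W) -> orth E W.
Proof.
elim=> {t E}[E E0 _|t i E' E A _ IH EA PA PW]; first exact: orth_zerol.
apply: orth_extl EA _ _; last by apply: PW PA; rewrite mem_rcons mem_head.
by apply: IH => j B jt; apply: PW; rewrite mem_rcons inE jt orbT.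
Qed.

Section StabilityTheory.
Variables (R : realType) (k : fieldType) (D : triCategory k).
Variable sigma : stabData R D.
Hypothesis hsigma : is_stability sigma.
Notation P := (slice sigma).
Implicit Types (phi psi : R) (A B E : D).

Lemma slice_iso phi A B : iso A B -> P phi A -> P phi B.
Proof. by have [isoP _ _] := stab_slice hsigma phi; exact: isoP. Qed.

Lemma slice_zero phi A : is_zero A -> P phi A.
Proof.
have [_ [Z Z0 PZ] _] := stab_slice hsigma phi => A0.
exact: slice_iso (zero_iso Z0 A0) PZ.
Qed.

Lemma slice_dsum phi A B S : is_dsum A B S -> P phi A -> P phi B -> P phi S.
Proof. by have [_ _ sumP] := stab_slice hsigma phi; exact: sumP. Qed.

Lemma slice_shift phi A : P phi A -> P (phi + 1) (shift D A).
Proof. by rewrite (stab_shift hsigma); exists A => //; exact: iso_refl. Qed.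

Lemma slice_shiftV phi A : P phi A ->
  exists2 B, P (phi - 1) B & iso (shift D B) A.
Proof. by rewrite -{1}[phi](subrK 1) (stab_shift hsigma) => -[B]; exists B. Qed.

Lemma slice_orth phi psi A B : psi < phi -> P phi A -> P psi B -> orth A B.
Proof. by move=> /(stab_hom hsigma) PQ PA PB f; exact: PQ f PA PB. Qed.

(** The semistable objects of phase [phi] are those with no map from a larger
    phase and to a smaller one: the extreme Harder-Narasimhan factors split off
    after a shift, hence vanish unless their phase is [phi]. *)
Lemma slice_criterion phi E :
  (forall psi A, phi < psi -> P psi A -> orth A E) ->
  (forall psi A, psi < phi -> P psi A -> orth E A) -> P phi E.
Proof.
have [/slice_zero //|/(stab_HN hsigma)[t t_sorted tE]] := pselect (is_zero E).
elim: tE t_sorted => {t E}[E E0 _ _ _|t i E' E A tE' IH E'EA PA].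
  exact: slice_zero.
rewrite sorted_gt_rcons => /andP[t_sorted /allP ti] from_gt to_lt.
have TE'A : orth (shift D E') A.
  have [B PB BA] := slice_shiftV PA.
  apply: orth_isor BA _; apply/orth_autoequiv/(filtered_orthl tE') => j C jt PC.
  by apply: slice_orth PC PB; apply: lt_trans (ti _ jt); rewrite gtrBl.
have [i_lt|i_gt|ei] := ltgtP i phi.
- have A0 : is_zero A by apply: is_ext_zeror E'EA _ TE'A; exact: to_lt i_lt PA.
  have E'E := is_ext_iso0r E'EA A0; apply: slice_iso (E'E) _; apply: IH => //.
    move=> psi B psi_gt PB; apply: orth_isor (iso_sym E'E) _.
    exact: from_gt psi_gt PB.
  move=> psi B psi_lt PB; apply: orth_isol (iso_sym E'E) _.
  exact: to_lt psi_lt PB.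
- apply/slice_zero/orth_self/(orth_extl E'EA); last exact: from_gt i_gt PA.
  apply: (filtered_orthl tE') => j B jt PB; apply: from_gt PB.
  exact: lt_trans (ti _ jt).
- have E'0 : is_zero E'.
    apply: is_ext_zerol E'EA _ TE'A.
    apply: (filtered_orthl tE') => j B jt PB; apply: from_gt PB.
    by rewrite -ei; exact: ti.
  by rewrite -ei; apply: slice_iso PA; exact/iso_sym/(is_ext_iso0l E'EA).
Qed.

(** Neither this nor closure under summands is an axiom; both hold because extensions and summands
    inherit the vanishing conditions of [slice_criterion]. *)
Lemma slice_ext phi A E B : is_ext A E B -> P phi A -> P phi B -> P phi E.
Proof.
move=> AEB PA PB; apply: slice_criterion => psi C psi_phi PC.
  by apply: orth_extr AEB _ _; exact: slice_orth psi_phi PC _.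
by apply: orth_extl AEB _ _; exact: slice_orth psi_phi _ PC.
Qed.

Lemma slice_summand phi A B S : is_dsum A B S -> P phi S -> P phi A.
Proof.
move=> ABS PS; apply: slice_criterion => psi C psi_phi PC.
  by apply: orth_summandr ABS _; exact: slice_orth psi_phi PC _.
by apply: orth_summandl ABS _; exact: slice_orth psi_phi _ PC.
Qed.

Definition phase_gt b := ext_closure (fun E => exists2 psi, b < psi & P psi E).
Definition phase_le b := ext_closure (fun E => exists2 psi, psi <= b & P psi E).

Lemma phase_cut b E : exists F G,
  [/\ is_ext F E G, phase_gt b F & phase_le b G].
Proof.
have [Z Z0] := tr_zero (triP D).
have [E0|/(stab_HN hsigma)[t t_sorted tE]] := pselect (is_zero E).
  by exists E, Z; split; [exact: is_ext_id0|exact: Ext_zero|exact: Ext_zero].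
elim: tE t_sorted => {t E}[E E0 _|t i E' E A tE' IH E'EA PA].
  by exists E, Z; split; [exact: is_ext_id0|exact: Ext_zero|exact: Ext_zero].
rewrite sorted_gt_rcons => /andP[/IH[F [G [FE'G bF bG]]] /allP ti].
(* The last factor has the smallest phase: if it exceeds [b], so do all the others, and the lower
   part is zero. *)
have [i_le|i_gt] := leP i b.
  have [Y FEY GYA] := is_ext_octa FE'G E'EA.
  exists F, Y; split=> //; apply: Ext_ext GYA bG _.
  by apply: Ext_gen; exists i.
exists E, Z; split; [exact: is_ext_id0| |exact: Ext_zero].
apply: Ext_ext E'EA _ (Ext_gen _); last by exists i.
apply: (filtered_ext_closure tE') => j B jt PB.
by exists j => //; exact: lt_trans i_gt (ti _ jt).
Qed.

Lemma phase_gt_shift b F : phase_gt b F -> phase_gt b (shift D F).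
Proof.
move: F; apply: ext_closure_ind_sub => [F [psi b_psi PF]|F F0|A F B AFB PA PB].
- apply: Ext_gen; exists (psi + 1); last exact: slice_shift.
  by rewrite ltr_wpDr.
- exact/Ext_zero/fobj_zero.
- exact: Ext_ext ((is_ext_shift _ _ _).1 AFB) PA PB.
Qed.

Lemma phase_gt_le_orth b F G : phase_gt b F -> phase_le b G -> orth F G.
Proof.
apply: ext_closure_orth => A B [phi b_phi PA] [psi psi_b PB].
exact: slice_orth (le_lt_trans psi_b b_phi) PA PB.
Qed.

End StabilityTheory.

Lemma filtered_sub (k : fieldType) (D : triCategory k) I (P Q : I -> set D) t E :
  (forall i A, P i A -> Q i A) -> filtered P t E -> filtered Q t E.
Proof.
move=> PQ; elim=> {t E}[E E0|t i E' E A _ QE' E'EA /PQ QA].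
  exact: Filtered0.
exact: FilteredS QE' E'EA QA.
Qed.

Lemma filtered_iso (k : fieldType) (D : triCategory k) I (P : I -> set D) t E F :
  iso E F -> filtered P t E -> filtered P t F.
Proof.
move=> EF tE; case: tE EF => {t E}[E E0|t i E' E A tE' E'EA PA] EF.
  exact/Filtered0/(iso_zero EF).
apply: FilteredS tE' _ PA; exact: is_ext_iso (iso_refl _) EF (iso_refl _) E'EA.
Qed.

(** The new factor [G] travels up the filtration past the factors of smaller
    phase, over which it splits. *)
Lemma filtered_insert (R : realType) (k : fieldType) (D : triCategory k)
    (Q Q' : R -> set D) b (G : D) : Q' b G ->
  (forall phi F, Q phi F -> Q' phi F) ->
  (forall phi F, phi < b -> Q phi F -> orth G (shift D F)) ->
  (forall F E, Q b F -> is_ext F E G -> Q' b E) ->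
  forall t E1, filtered Q t E1 -> sorted >%R t ->
  forall E, is_ext E1 E G ->
  exists t', [/\ sorted >%R t', filtered Q' t' E
    & forall x, all (fun y => x < y) t -> x < b -> all (fun y => x < y) t'].
Proof.
move=> Q'G QQ' Qorth Qmerge t E1.
elim=> {t E1}[E1 E10 _ E E1EG|t i E' E1 F tE' IH E'E1F QF].
  exists (rcons [::] b); split=> [//||x _ /= ->//].
  exact: FilteredS (Filtered0 _ E10) E1EG Q'G.
rewrite sorted_gt_rcons => /andP[t_sorted ti] E E1EG.
have [Y E'EY FYG] := is_ext_octa E'E1F E1EG.
have [i_lt|i_gt|ei] := ltgtP i b.
- have GYF := is_ext_swap FYG (Qorth _ _ i_lt QF).
  have [E2 E'E2G E2EF] := is_ext_octa' E'EY GYF.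
  have [t' [t'_sorted t'E2 t'_gt]] := IH t_sorted _ E'E2G.
  exists (rcons t' i); split=> [||x].
  + by rewrite sorted_gt_rcons t'_sorted t'_gt.
  + by apply: FilteredS t'E2 E2EF _; exact: QQ'.
  + by rewrite !all_rcons => /andP[-> /t'_gt].
- exists (rcons (rcons t i) b); split=> [||x].
  + rewrite !sorted_gt_rcons t_sorted ti all_rcons i_gt /=.
    by apply: sub_all ti => y; exact: lt_trans.
  + apply: FilteredS E1EG Q'G; apply: FilteredS E'E1F (QQ' _ _ QF).
    exact: filtered_sub QQ' tE'.
  + by move=> xt xb; rewrite all_rcons xb.
- exists (rcons t i); split=> [||//].
  + by rewrite sorted_gt_rcons t_sorted ti.
  + apply: FilteredS (filtered_sub QQ' tE') E'EY _.
    by rewrite ei in QF *; exact: Qmerge FYG.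
Qed.

(** * Serre duality and polar form of the charges *)

Section CalabiYau.
Variables (k : fieldType) (D : triCategory k) (X : autoequiv D).
Hypothesis hCY : calabi_yau X.

(** Injectivity of the duality gives one implication; the other is the same one for [B] and [X A],
    as [X] is fully faithful. *)
Lemma calabi_yau_orth (A B : D) : orth A B <-> orth B (X A).
Proof.
have [eta [_ eta_inj _ _ _]] := hCY.
have CY C E : orth E (X C) -> orth C E.
  by move=> EXC f; apply: eta_inj => g; rewrite (EXC g) linear0.
by split=> [AB|]; [apply: CY; apply/orth_autoequiv | exact: CY].
Qed.

End CalabiYau.

Section ExpIPi.
Variable R : realType.
Implicit Types (z w : R[i]) (x : R).
Notation normc := ComplexField.Normc.normc.

Lemma expipiD z w : expipi (z + w) = expipi z * expipi w.
Proof.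
case: z w => [a b] [c d]; rewrite /expipi /=.
rewrite !mulrDr cosD sinD expRD.
by apply/eqP; rewrite eq_complex /=; apply/andP; split; apply/eqP; ring.
Qed.

Lemma normc_expipi z : normc (expipi z) = expR (- pi * complex.Im z).
Proof.
case: z => [a b]; rewrite /expipi ComplexField.Normc.normcM /= cos2Dsin2.
by rewrite sqrtr1 mulr1 expr0n addr0 sqrtr_sqr gtr0_norm// expR_gt0.
Qed.

Lemma normc_expipi_gt0 z : 0 < normc (expipi z).
Proof. by rewrite normc_expipi expR_gt0. Qed.

Lemma expipi_polar z : expipi z = (normc (expipi z))%:C%C * expipi (complex.Re z)%:C%C.
Proof.
by rewrite normc_expipi /expipi /= mulr0 expR0; case: z => a b /=; rewrite mul1r.
Qed.

Lemma expipi_neq0 z : expipi z != 0.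
Proof.
by apply/eqP => z0; have := normc_expipi_gt0 z; rewrite z0 ComplexField.Normc.normc0 ltxx.
Qed.

Lemma normc_ray m x : 0 <= m -> normc (m%:C%C * expipi x%:C%C) = m.
Proof.
move=> m0; rewrite ComplexField.Normc.normcM normc_expipi /= mulr0 expR0 mulr1.
by rewrite expr0n addr0 sqrtr_sqr ger0_norm.
Qed.

End ExpIPi.

Lemma big_ord_pad (V : nmodType) (m n : nat) (F : nat -> V) : (m <= n)%N ->
  (forall i, (m <= i)%N -> F i = 0) -> \sum_(i < m) F i = \sum_(i < n) F i.
Proof.
move=> mn F0; rewrite (big_ord_widen n F mn) big_mkcond; apply: eq_bigr => i _.
by case: ltnP => // /F0.
Qed.

Lemma lattice_norm0 (R : realType) (A : zmodType) (nrm : A -> R) : lattice_norm nrm -> nrm 0 = 0.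
Proof.
move=> [n [b [N [_ [_ NZ _] nrmE]]]].
have -> : 0 = int_comb b 0 by rewrite /int_comb big1 // => i _; rewrite mxE mulr0z.
rewrite nrmE (_ : map_mx _ _ = 0 *: 0); last by apply/matrixP => i j; rewrite !mxE mul0r.
by rewrite NZ normr0 mul0r.
Qed.

(** * Induced stability conditions *)

Section Induced.
Variables (R : realType) (k : fieldType) (D : triCategory k) (X : autoequiv D).
Hypothesis X_exact : exact_functor X.
Hypothesis hCY : calabi_yau X.
Variable (H : set D).
Hypothesis hH : baric_heart X H.
Variable sigma : stabData R (heart hH).
Hypothesis hsigma : is_stability sigma.
Variable s : R[i].
Notation P := (slice sigma).
Notation r := (complex.Re s).
Notation normc := ComplexField.Normc.normc.
Notation incl := (@heart_incl k D X H hH).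
Notation Z := (induced_charge sigma s).
Implicit Types (A B E F G : D) (l m : int) (phi psi : R).

Definition lslice l phi : set D :=
  ess_im (fun A : heart hH => xpow X l (heart_ob A)) (P (phi - l%:~R * r)).

Lemma induced_genP phi E : induced_gen sigma s phi E <-> exists l, lslice l phi E.
Proof. by split=> [[l _ lE]|[l lE]]; exists l. Qed.

Lemma lslice_level l phi E : lslice l phi E -> level X H l E.
Proof. by case=> B _ BE; exists (heart_ob B) => //; exact: svalP B. Qed.

Lemma lslice_shift l phi : ess_im (shift D) (lslice l phi) = lslice l (phi + 1).
Proof.
rewrite /lslice addrAC; apply/seteqP; split=> E.
  move=> [A [B PB BA] AE]; exists (shift (heart hH) B).
    exact: (slice_shift hsigma).
  apply: iso_trans (xpow_shift X_exact _ _) _.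
  exact: iso_trans (fobj_iso _ BA) AE.
rewrite (stab_shift hsigma) => -[B' [B PB [f [g [gf fg]]]] BE].
exists (xpow X l (heart_ob B)); first by exists B => //; exact: iso_refl.
apply: iso_trans (iso_sym (xpow_shift X_exact _ _)) _.
apply: iso_trans BE; apply: xpow_iso; exists f, g; exact: conj gf fg.
Qed.

Lemma lslice_X l phi : ess_im X (lslice l phi) = lslice (l + 1) (phi + r).
Proof.
rewrite /lslice intrD mulrDl mul1r opprD addrACA subrr addr0.
apply/seteqP; split=> E.
  move=> [A [B PB BA] AE]; exists B => //.
  by apply: iso_trans (xpowS _ _ _) _; exact: iso_trans (fobj_iso _ BA) AE.
move=> [B PB BE]; exists (xpow X l (heart_ob B)).
  by exists B => //; exact: iso_refl.
exact: iso_trans (iso_sym (xpowS _ _ _)) BE.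
Qed.

Lemma induced_gen_shift phi :
  ess_im (shift D) (induced_gen sigma s phi) = induced_gen sigma s (phi + 1).
Proof.
apply/seteqP; split=> E.
  move=> [A [l _ lA] AE]; exists l => //.
  by rewrite -/(lslice l (phi + 1)) -lslice_shift; exists A.
move=> [l _]; rewrite -/(lslice l (phi + 1)) -lslice_shift => -[A lA AE].
by exists A => //; exists l.
Qed.

Lemma induced_gen_X phi :
  ess_im X (induced_gen sigma s phi) = induced_gen sigma s (phi + r).
Proof.
apply/seteqP; split=> E.
  move=> [A [l _ lA] AE]; exists (l + 1) => //.
  by rewrite -/(lslice (l + 1) (phi + r)) -lslice_X; exists A.
move=> [l _]; rewrite -[l](subrK 1) -/(lslice _ (phi + r)) -lslice_X => -[A lA AE].
by exists A => //; exists (l - 1).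
Qed.

(** From level [l] up to level [l + 1], Serre duality turns maps into maps of
    the heart in the opposite direction; further up it kills them. *)
Lemma lslice_orth_lt l m phi psi A B : (l < m)%R -> lslice l phi A -> lslice m psi B ->
  (m = l + 1 -> hom_vanish (P (psi - m%:~R * r)) (P (phi - l%:~R * r))) ->
  orth A B.
Proof.
move=> lm lA; rewrite -[m in lslice m](subrK 1) -[psi in lslice _ psi](subrK r) -lslice_X.
move=> [C mC CB] PQ; apply: orth_isor CB _; apply: (calabi_yau_orth hCY C A).1.
have [ml|/eqP ml] := eqVneq m (l + 1); last first.
  by apply: (level_orth hH _ (lslice_level mC) (lslice_level lA)); lia.
have el : m - 1 = l by rewrite ml addrK.
case: mC; rewrite el => C' PC CC'; case: lA => A' PA AA'.
apply: orth_isol CC' _; apply: orth_isor AA' _; apply/xpow_orth => f.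
apply: (PQ ml C' A' f) PA.
by rewrite ml intrD mulrDl mul1r opprD addrA addrAC.
Qed.

Lemma lslice_orth_level l phi psi A B : psi < phi -> lslice l phi A -> lslice l psi B ->
  orth A B.
Proof.
move=> psi_phi [A' PA AA'] [B' PB BB'].
apply: orth_isol AA' _; apply: orth_isor BB' _; apply/xpow_orth => f.
by apply: (stab_hom hsigma _ (f : hom A' B')) PA PB; rewrite ltrD2r.
Qed.

Definition gap_gt : Prop := forall phi psi, r - 1 < psi - phi ->
  hom_vanish (P phi) (P psi).

Definition gap_ge : Prop := forall phi psi, r - 1 <= psi - phi ->
  hom_vanish (P phi) (P psi).

Lemma gap_ge_gt : gap_ge -> gap_gt.
Proof. by move=> gap phi psi /ltW; exact: gap. Qed.

Lemma gldim_gap : (gldim sigma <= (r - 1)%:E)%E <-> gap_gt.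
Proof.
split=> [le_gldim phi psi lt_gap|gap].
  apply: contrapT => nPQ; move: lt_gap; rewrite ltNge -lee_fin => /negP; apply.
  by apply: le_trans le_gldim; apply: ereal_sup_ubound; exists phi, psi.
apply: ge_ereal_sup => _ [phi [psi [nPQ ->]]]; rewrite lee_fin leNgt.
by apply/negP => /gap.
Qed.

(** From level [l] to [l + 1] the dual map raises the phase by [phi - psi + r], well beyond [r - 1];
    the bound becomes sharp only for maps into a shift. *)
Lemma lslice_orth l m phi psi A B : gap_gt -> psi < phi ->
  lslice l phi A -> lslice m psi B -> orth A B.
Proof.
move=> gap psi_phi lA mB; have [lm|ml|e] := ltgtP l m.
- apply: lslice_orth_lt lm lA mB _ => ->; apply: gap.
  by rewrite intrD mulrDl mul1r; lra.
- exact: level_orth ml (lslice_level lA) (lslice_level mB).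
- by rewrite -e in mB; exact: lslice_orth_level lA mB.
Qed.

Lemma lslice_shift_orth l m phi psi F G : (l < m)%R ->
  (m = l + 1 -> hom_vanish (P (phi + 1 - m%:~R * r)) (P (psi - l%:~R * r))) ->
  lslice m phi F -> lslice l psi G -> orth G (shift D F).
Proof.
move=> lm PQ mF lG; apply: lslice_orth_lt lm lG _ PQ.
by rewrite -lslice_shift; exists F => //; exact: iso_refl.
Qed.

Lemma lslice_split_lt l m phi psi F G : gap_gt -> (l < m)%R -> phi < psi ->
  lslice m phi F -> lslice l psi G -> orth G (shift D F).
Proof.
move=> gap lm phi_psi; apply: lslice_shift_orth => // ->; apply: gap.
by rewrite intrD mulrDl mul1r; lra.
Qed.

Lemma lslice_split_le l m phi F G : gap_ge -> (l < m)%R ->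
  lslice m phi F -> lslice l phi G -> orth G (shift D F).
Proof.
move=> gap lm; apply: lslice_shift_orth => // ->; apply: gap.
by rewrite intrD mulrDl mul1r; lra.
Qed.

Lemma level_filtered l E : level X H l E ->
  exists2 t, sorted >%R t & filtered (lslice l) t E.
Proof.
move=> [A HA AE]; pose B : heart hH := exist _ A HA.
have [B0|/(stab_HN hsigma)[t t_sorted tB]] := pselect (is_zero B).
  by exists [::] => //; apply/Filtered0/(iso_zero AE)/xpow_zero.
exists [seq x + l%:~R * r | x <- t].
  rewrite sorted_map; apply: sub_sorted t_sorted => x y /=.
  by rewrite ltrD2r.
apply: filtered_iso AE _; rewrite -[A]/(heart_ob B).
elim: tB {t_sorted} => {t}[C C0|t i C' C F _ IH C'CF PF].
  by apply/Filtered0/xpow_zero.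
rewrite map_rcons; apply: FilteredS IH _ _.
  exact: (xpow_ext X_exact l _ _ _).1 C'CF.
by exists F; [rewrite addrK | exact: iso_refl].
Qed.

(** * Harder-Narasimhan filtrations for both slicings *)

Section HarderNarasimhan.
(** Either closure. They differ in [cl_merge], which absorbs a piece of equal phase: as an extension
    in one case, as a direct summand in the other. *)
Variable cl : set D -> set D.
Hypothesis cl_gen : forall Q E, Q E -> cl Q E.
Hypothesis cl_sub : forall Q Q' : set D, (forall E, Q E -> Q' E) ->
  forall E, cl Q E -> cl Q' E.
Hypothesis cl_split : forall (Q : set D) G,
  (forall F, Q F -> orth G (shift D F)) ->
  forall F, cl Q F -> orth G (shift D F).
Hypothesis cl_merge : forall l phi (Q Q' : set D) F E G, is_ext F E G ->
  (forall A, Q A -> exists2 m, (l < m)%R & lslice m phi A) ->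
  (forall A, Q A -> Q' A) -> cl Q F -> lslice l phi G -> Q' G -> cl Q' E.
Hypothesis gap : gap_gt.

(** [p] marks the phases at which level [l] may occur beside the higher levels. Factors of level [l]
    are inserted by decreasing phase, so that a new one meets only strictly higher levels at its own
    phase and below. *)
Let fam l (p : R -> bool) phi : set D :=
  cl (fun A => exists2 m, (l < m)%R || (m == l) && p phi & lslice m phi A).

Lemma filtered_merge l E' tE' t A E : filtered (fam l xpred0) tE' E' ->
  sorted >%R tE' -> filtered (lslice l) t A -> sorted >%R t -> is_ext E' E A ->
  exists2 t', sorted >%R t' & filtered (fam l (fun phi => has (<= phi) t)) t' E.
Proof.
move=> tE'P tE'_sorted tA; move: E.
elim: tA => {t A}[A A0 E _ E'EA|t i A' A G _ IH A'AG lG E].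
  exists tE' => //; apply: filtered_iso (is_ext_iso0r E'EA A0) _.
  exact: tE'P.
rewrite sorted_gt_rcons => /andP[t_sorted /allP ti] E'EA.
have [E1 E'E1A' E1EG] := is_ext_octa' E'EA A'AG.
have [t1 t1_sorted t1E1] := IH _ t_sorted E'E1A'.
have t_gt phi : phi <= i -> has (<= phi) t = false.
  move=> phi_i; apply/hasP => -[x /ti ix /= x_phi].
  by move: (lt_le_trans ix (le_trans x_phi phi_i)); rewrite ltxx.
have p_sub phi F : (exists2 m, (l < m)%R || (m == l) && has (<= phi) t
      & lslice m phi F) ->
    exists2 m, (l < m)%R || (m == l) && has (<= phi) (rcons t i) & lslice m phi F.
  by move=> [m lm mF]; exists m => //; rewrite has_rcons;
    case: (has _ t) lm => /=; rewrite ?orbT// andbF orbF => ->.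
have Gi : exists2 m, (l < m)%R || (m == l) && has (<= i) (rcons t i)
    & lslice m i G.
  by exists l => //; rewrite ltxx eqxx has_rcons /= lexx.
have Q'G : fam l (fun phi => has (<= phi) (rcons t i)) i G by exact: cl_gen.
have QQ' phi F : fam l (fun phi => has (<= phi) t) phi F ->
    fam l (fun phi => has (<= phi) (rcons t i)) phi F.
  by apply: cl_sub; exact: p_sub.
have [||t' [t'_sorted t'E _]] :=
  filtered_insert Q'G QQ' _ _ t1E1 t1_sorted E1EG; last by exists t'.
- move=> phi F phi_i; apply: cl_split => {}F [m].
  rewrite (t_gt phi (ltW phi_i)) andbF orbF => lm mF.
  exact: lslice_split_lt gap lm phi_i mF lG.
- move=> F E2 QF FE2G; apply: cl_merge FE2G _ (@p_sub i) QF lG Gi => B [m].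
  by rewrite (t_gt i (lexx i)) andbF orbF; exists m.
Qed.

Lemma induced_HN E : exists2 t, sorted >%R t
  & filtered (fun phi => cl (induced_gen sigma s phi)) t E.
Proof.
have [E0|/(baric_filtration hH)[t t_sorted tE]] := pselect (is_zero E).
  by exists [::] => //; exact: Filtered0.
(* The lower bound [j] on levels is generalized: levels decrease strictly, so what precedes a piece
   of level [l] can be filtered with levels at least [l + 1]. *)
suff /(_ (0 - (\max_(l <- t) absz l)%N%:Z)) : forall j, all (fun l => j <= l) t ->
    exists2 t', sorted >%R t' & filtered (fun phi =>
      cl (fun A => exists2 m, (j <= m)%R & lslice m phi A)) t' E.
  case=> [|t' t'_sorted t'E].
    apply/allP => l lt /=.
  have : (absz l <= \max_(l <- t) absz l)%N by exact: (@leq_bigmax_seq _ _ xpredT).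
  lia.
  exists t' => //; apply: filtered_sub t'E => phi A; apply: cl_sub => B [m _ mB].
  by exists m.
elim: tE t_sorted => {t E}[E E0 _ j _|t l E' E A _ IH E'EA lA].
  by exists [::] => //; exact: Filtered0.
rewrite sorted_gt_rcons => /andP[t_sorted tl] j; rewrite all_rcons => /andP[jl _].
have [t1 t1_sorted t1E'] : exists2 t', sorted >%R t' & filtered (fam l xpred0) t' E'.
  have [|t' t'_sorted t'E'] := IH t_sorted (l + 1).
    by apply: sub_all tl => m lm; lia.
  exists t' => //; apply: filtered_sub t'E' => phi B; apply: cl_sub => C [m lm mC].
  by exists m => //; rewrite (_ : (l < m)%R)//; lia.
have [t2 t2_sorted t2A] := level_filtered lA.
have [t' t'_sorted t'E] := filtered_merge t1E' t1_sorted t2A t2_sorted E'EA.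
exists t' => //; apply: filtered_sub t'E => phi B; apply: cl_sub => C [m lm mC].
by exists m => //; case/orP: lm => [|/andP[/eqP -> _]]; lia.
Qed.

End HarderNarasimhan.

(** * Induced charges, and sufficiency of the gap conditions *)

Let act l (x : K0 (heart hH)) := expipi (s *~ l) * charge sigma x.

Let act_morph l : zmod_morphism (act l).
Proof. by move=> x y; rewrite /act (stab_charge hsigma) mulrBr. Qed.

Lemma induced_charge_morph : zmod_morphism Z.
Proof. exact: (tensor_lift_morph X_exact act_morph). Qed.

Lemma induced_charge_qact l x :
  Z (qact X l (incl x)) = expipi (s *~ l) * charge sigma x.
Proof. exact: (tensor_lift_qact X_exact act_morph l x). Qed.

(** A nonnegative mass that detects zero objects adds up along extensions even when some pieces
    vanish, unlike the strict positivity of the axiom. *)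
Lemma charge_cls phi (B : heart hH) : P phi B ->
  exists2 m, 0 <= m & charge sigma (cls B) = m%:C%C * expipi phi%:C%C /\
    (m = 0 -> is_zero B).
Proof.
have [B0 _|B0 /(stab_phase hsigma)/(_ B0)[m m0 e]] := pselect (is_zero B).
  exists 0 => //; split=> //.
  by rewrite (cls_zero B0) (zmod_morph0 (stab_charge hsigma)) mul0r.
by exists m; [exact: ltW | split=> // m0'; rewrite m0' ltxx in m0].
Qed.

(** [q^l] scales and rotates by [l * r]; the rotation cancels the offset in the phase of the level
    [l] generators, so that they all lie on the ray of [phi]. *)
Lemma expipi_level l phi :
  expipi (s *~ l) * expipi (phi - l%:~R * r)%:C%C
  = (normc (expipi (s *~ l)))%:C%C * expipi phi%:C%C.
Proof.
have Re_sl : complex.Re (s *~ l) = l%:~R * r.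
  by rewrite mulrzl raddfMz.
rewrite {1}expipi_polar Re_sl -mulrA -expipiD -rmorphD.
by rewrite [l%:~R * r + _]addrC subrK.
Qed.

Lemma charge_level l phi (B : heart hH) : P (phi - l%:~R * r) B ->
  exists2 m, 0 <= m &
    [/\ charge sigma (cls B) = m%:C%C * expipi (phi - l%:~R * r)%:C%C,
        expipi (s *~ l) * charge sigma (cls B)
          = (normc (expipi (s *~ l)) * m)%:C%C * expipi phi%:C%C
      & m = 0 -> is_zero B].
Proof.
move=> /charge_cls[m m0 [e mz]]; exists m => //; split=> //.
by rewrite e mulrCA expipi_level mulrA -rmorphM /= [m * _]mulrC.
Qed.

Lemma charge_star phi E : ext_closure (induced_gen sigma s phi) E ->
  exists2 m, 0 <= m & Z (cls E) = m%:C%C * expipi phi%:C%C /\ (m = 0 -> is_zero E).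
Proof.
move: E; apply: ext_closure_ind_sub => [E /induced_genP[l [B PB BE]]|E E0|A E B].
- have [m m0 [_ e mz]] := charge_level PB.
  exists (normc (expipi (s *~ l)) * m).
    by apply: mulr_ge0 => //; exact/ltW/normc_expipi_gt0.
  split.
    by rewrite -(cls_iso BE) -(qact_incl_cls X_exact) induced_charge_qact.
  move=> /eqP; rewrite mulf_eq0 (gt_eqF (normc_expipi_gt0 _)) /= => /eqP/mz B0.
  exact/(iso_zero BE)/xpow_zero.
- exists 0 => //; split=> //.
  by rewrite (cls_zero E0) (zmod_morph0 induced_charge_morph) mul0r.
move=> AEB [m m0 [em mz]] [m' m0' [em' mz']]; exists (m + m').
  exact: addr_ge0.
split.
  by rewrite (cls_ext AEB) (zmod_morphD induced_charge_morph) em em' rmorphD mulrDl.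
move=> /eqP; rewrite paddr_eq0// => /andP[/eqP/mz A0 /eqP/mz' B0].
exact: is_ext_zero AEB A0 B0.
Qed.

Lemma phase_of_ray (Q : set D) phi E :
  (forall E, Q E -> ext_closure (induced_gen sigma s phi) E) -> Q E -> ~ is_zero E ->
  exists2 m : R, 0 < m & Z (cls E) = (m%:C)%C * expipi (phi%:C)%C.
Proof.
move=> QP /QP/charge_star[m m0 [e mz]] E0; exists m => //.
by rewrite lt_neqAle m0 andbT eq_sym; apply/eqP => /mz.
Qed.

Lemma ext_closure_shift_split (Q : set D) G :
  (forall F, Q F -> orth G (shift D F)) ->
  forall F, ext_closure Q F -> orth G (shift D F).
Proof.
move=> QG; apply: ext_closure_ind_sub => // [F F0|A F B AFB GA GB].
  exact/orth_zeror/fobj_zero.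
apply: (orth_extr ((is_ext_shift _ _ _).1 AFB)) => //.
Qed.

Lemma add_closure_shift_split (Q : set D) G :
  (forall F, Q F -> orth G (shift D F)) ->
  forall F, add_closure Q F -> orth G (shift D F).
Proof.
move=> QG; apply: add_closure_ind_sub => // [F F0|A B S AS GA GB|A B S AS GS].
- exact/orth_zeror/fobj_zero.
- exact: orth_dsumr (fobj_dsum (shift D) AS) GA GB.
- exact: orth_summandr (fobj_dsum (shift D) AS) GS.
Qed.

Theorem star_stability : gap_gt -> is_stability (sigma_star sigma s).
Proof.
move=> gap; split=> /=.
- exact: induced_charge_morph.
- by move=> phi; exact: ext_closure_additive.
- by move=> phi E PE E0; exact: (phase_of_ray (Q := ext_closure _)) PE E0.
- move=> phi; apply/esym; apply: (ext_closure_ess_im (shift_exact D)).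
  exact: induced_gen_shift.
- move=> phi psi psi_phi A B f PA PB; move: A B PA PB f.
  apply: ext_closure_orth => A B /induced_genP[l lA] /induced_genP[m mB].
  exact: lslice_orth gap psi_phi lA mB.
- move=> E _; apply: (induced_HN (cl := @ext_closure k D)) => //.
  + exact: Ext_gen.
  + move=> Q Q' QQ'; apply: ext_closure_sub => A /QQ'; exact: Ext_gen.
  + exact: ext_closure_shift_split.
  + move=> l phi Q Q' F E1 G FE1G _ QQ' QF _ Q'G.
    apply: Ext_ext FE1G _ (Ext_gen Q'G).
    by apply: ext_closure_sub QF => A /QQ'; exact: Ext_gen.
Qed.

(** Summands are the only issue: they stay in the extension closure because that closure is a slice
    of a stability condition. *)
Lemma oplus_sub_star : gap_gt -> forall phi E,
  add_closure (induced_gen sigma s phi) E -> ext_closure (induced_gen sigma s phi) E.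
Proof.
move=> /star_stability star phi; apply: add_closure_ind_sub => [E|E|A B S|A B S].
- exact: Ext_gen.
- exact: Ext_zero.
- by move/is_ext_dsum; exact: Ext_ext.
- by move=> ABS; exact: (slice_summand star ABS (phi := phi)).
Qed.

Theorem oplus_stability : gap_ge -> is_stability (sigma_oplus sigma s).
Proof.
move=> gap; have gap' := gap_ge_gt gap; split=> /=.
- exact: induced_charge_morph.
- by move=> phi; exact: add_closure_additive.
- by move=> phi E PE E0; exact: (phase_of_ray (@oplus_sub_star gap' phi)) PE E0.
- by move=> phi; apply/esym/add_closure_ess_im/induced_gen_shift.
- move=> phi psi psi_phi A B f PA PB; move: A B PA PB f.
  apply: add_closure_orth => A B /induced_genP[l lA] /induced_genP[m mB].
  exact: lslice_orth gap' psi_phi lA mB.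
- move=> E _; apply: (induced_HN (cl := @add_closure k D)) => //.
  + exact: Add_gen.
  + move=> Q Q' QQ'; apply: add_closure_sub => A /QQ'; exact: Add_gen.
  + exact: add_closure_shift_split.
  + move=> l phi Q Q' F E1 G FE1G Qgen QQ' QF lG Q'G.
    (* All levels in [F] exceed [l], so the nonstrict gap condition splits the extension even at
       equal phase. *)
    have GF : orth G (shift D F).
      move: F QF {FE1G}; apply: add_closure_shift_split => F /Qgen[m lm mF].
      exact: lslice_split_le lm mF lG.
    apply: Add_sum (is_ext_split FE1G GF) _ (Add_gen Q'G).
    by apply: add_closure_sub QF => A /QQ'; exact: Add_gen.
Qed.

Lemma level_orth_far l m A B : (l + 1 < m)%R -> level X H l A -> level X H m B ->
  orth A B.
Proof.
move=> lm lA mB.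
have BX : iso (X (bwd X B)) B by exact: fwd_bwd_iso.
apply: orth_isor (BX) _; apply: (calabi_yau_orth hCY _ _).1.
apply: (level_orth hH (l := m - 1)) lA; first by lia.
by apply/(level_succ hH); rewrite subrK; exact: level_iso hH _ _ _ (iso_sym BX) mB.
Qed.

(** * Necessity of the gap conditions *)

Section Necessity.
Variable tau : stabData R D.
Hypothesis htau : is_stability tau.
Hypothesis tau_gen : forall phi E, induced_gen sigma s phi E -> slice tau phi E.

Let so := level_semiorthogonal X_exact hH 1.

(** A map [A -> B] of the heart is dual to a map [B -> X A], the connecting map
    of an extension [M] of [B] by [X A [-1]]: [M] is already cut by its levels,
    so a cut by phases in the opposite order splits it. *)
Lemma gap_from_split phi psi (A B : heart hH) :
  P phi A -> P psi B ->
  (forall C M, slice tau (phi + r - 1) C -> level_ge X H 1 C ->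
     slice tau psi (heart_ob B) -> is_ext C M (heart_ob B) ->
     exists F G, [/\ is_ext F M G, level_lt X H 1 F & level_ge X H 1 G]) ->
  orth (heart_ob A) (heart_ob B).
Proof.
move=> PA PB cut; apply: (calabi_yau_orth hCY _ _).2.
have XA1 : lslice 1 (phi + r) (X (heart_ob A)).
  rewrite -[1]add0r -lslice_X; exists (heart_ob A); last exact: iso_refl.
  by exists A; [rewrite mul0r subr0 | exact: iso_refl].
have [C PC CXA] : exists2 C, slice tau (phi + r - 1) C
    & iso (shift D C) (X (heart_ob A)).
  by apply: (slice_shiftV htau); apply/tau_gen/induced_genP; exists 1.
have C1 : level_ge X H 1 C.
  apply: (level_ge_gen (l := 1)) => //; apply/(level_shift X_exact hH).
  exact: level_iso hH _ _ _ (iso_sym CXA) (lslice_level XA1).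
have B0 : level_lt X H 1 (heart_ob B).
  apply: (level_lt_gen (l := 0)) => //; apply/(level0 hH); exact: svalP B.
have PtB : slice tau psi (heart_ob B).
  apply/tau_gen/induced_genP; exists 0; exists B; last exact: iso_refl.
  by rewrite mul0r subr0.
apply: orth_isor CXA _ => g.
have [M [b [h bgh]]] := cocone_exists g.
have [a def_a] := fmap_full (- h).
have abg : dist a b g by apply/dist_rotE; rewrite def_a opprK.
have [F [G [FMG F0 G1]]] := cut C M PC C1 PtB (is_extP abg).
exact: (so_split so abg C1 B0 FMG F0 G1).
Qed.

Lemma gap_gt_necessary :
  (forall phi E, slice tau phi E -> exists A B, [/\ is_ext A E B,
     level_ge X H 1 A, level_lt X H 1 B, slice tau phi A & slice tau phi B]) ->
  gap_gt.
Proof.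
move=> trunc phi psi lt_gap A B f PA PB; move: f.
apply: (gap_from_split PA PB) => C M PC C1 PtB CMB.
(* Cutting at the phase of [C] puts [C] on the lower side and [B], of phase [psi], on the upper one:
   phases order the two pieces oppositely to levels. *)
set b := phi + r - 1 in PC.
have b_psi : b < psi by rewrite /b; lra.
have [Z0 Z00] := tr_zero (triP D).
have zU : exists2 Z, level_ge X H 1 Z & is_zero Z.
  by exists Z0 => //; exact: Ext_zero.
have zV : exists2 Z, level_lt X H 1 Z & is_zero Z.
  by exists Z0 => //; exact: Ext_zero.
have truncS (S : set R) E : ext_closure (fun E => exists2 x, S x & slice tau x E) E ->
    exists A B, [/\ is_ext A E B, level_ge X H 1 A, level_lt X H 1 B,
      ext_closure (fun E => exists2 x, S x & slice tau x E) A
    & ext_closure (fun E => exists2 x, S x & slice tau x E) B].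
  move: E; apply: (so_trunc_closure so) zU zV => E [x Sx /trunc[A' [B' [AEB UA VB PA' PB']]]].
  by exists A', B'; split=> //; apply: Ext_gen; exists x.
have [F [G [FMG bF bG]]] := phase_cut htau b M.
have [FU [FV [FUV UFU VFV bFU bFV]]] := truncS (fun x => b < x) F bF.
have [GU [GV [GUV UGU VGV bGU bGV]]] := truncS (fun x => x <= b) G bG.
have B0 : level_lt X H 1 (heart_ob B).
  apply: (level_lt_gen (l := 0)) => //; apply/(level0 hH); exact: svalP B.
have [FCG FBG] := so_trunc_ext so FMG FUV CMB GUV UFU VFV C1 B0 UGU VGV.
have C_le : phase_le tau b C by apply: Ext_gen; exists b.
have B_gt : phase_gt tau b (heart_ob B) by apply: Ext_gen; exists psi.
(* In [FU -> C -> GU] the first map goes from phases above [b] to [b], and maps [T FU -> GU] vanish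
   too, so [FU] is zero. Dually, [B -> GV] vanishes and so does [GV]. *)
have FU0 : is_zero FU.
  apply: is_ext_zerol FCG (phase_gt_le_orth htau bFU C_le) _.
  exact: (phase_gt_le_orth htau (phase_gt_shift htau bFU) bGU).
have GV0 : is_zero GV.
  apply: is_ext_zeror FBG (phase_gt_le_orth htau B_gt bGV) _.
  exact: (phase_gt_le_orth htau (phase_gt_shift htau bFV) bGV).
exists F, G; split=> //.
  exact: ext_closure_iso (iso_sym (is_ext_iso0l FUV FU0)) VFV.
exact: ext_closure_iso (is_ext_iso0r GUV GV0) UGU.
Qed.

(** Only equality goes beyond the previous lemma: there [C] and [B] share the phase [psi], so [M]
    lies in that slice and splits by levels without a cut by phases. *)
Lemma gap_ge_necessary :
  (forall phi E, slice tau phi E -> exists A B, [/\ is_dsum A B E,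
     level_ge X H 1 A & level_lt X H 1 B]) ->
  gap_ge.
Proof.
move=> split phi psi; rewrite le_eqVlt => /orP[/eqP e|]; last first.
  apply: gap_gt_necessary => {}phi E PE; have [A [B [ABE UA VB]]] := split _ _ PE.
  exists A, B; split=> //; first exact: is_ext_dsum.
    exact: (slice_summand htau) ABE PE.
  exact: (slice_summand htau) (is_dsum_sym ABE) PE.
move=> A B f PA PB; move: f; apply: (gap_from_split PA PB) => C M PC C1 PtB CMB.
have e' : phi + r - 1 = psi by lra.
rewrite e' in PC; have PM := slice_ext htau CMB PC PtB.
have [G [F [GFM UG VF]]] := split _ _ PM.
by exists F, G; split=> //; exact/is_ext_dsum/is_dsum_sym.
Qed.

End Necessity.

Lemma induced_gen_trunc phi E : induced_gen sigma s phi E ->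
  exists A B, [/\ is_ext A E B, level_ge X H 1 A, level_lt X H 1 B,
    ext_closure (induced_gen sigma s phi) A & ext_closure (induced_gen sigma s phi) B].
Proof.
have [Z0 Z00] := tr_zero (triP D); move=> lE; have [l El] := (induced_genP _ _).1 lE.
have [l1|l0] := leP 1 l.
  exists E, Z0; split; [exact: is_ext_id0| |exact: Ext_zero|exact: Ext_gen|exact: Ext_zero].
  exact: level_ge_gen l1 (lslice_level El).
exists Z0, E; split; [exact: is_ext_0id|exact: Ext_zero| |exact: Ext_zero|exact: Ext_gen].
exact: level_lt_gen l0 (lslice_level El).
Qed.

Lemma star_gap : is_stability (sigma_star sigma s) -> gap_gt.
Proof.
move=> star; apply: (gap_gt_necessary star) => [phi E|phi]; first exact: Ext_gen.
have [Z0 Z00] := tr_zero (triP D).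
apply: (so_trunc_closure (level_semiorthogonal X_exact hH 1)).
- exact: induced_gen_trunc.
- by exists Z0 => //; exact: Ext_zero.
- by exists Z0 => //; exact: Ext_zero.
Qed.

Lemma oplus_gap : is_stability (sigma_oplus sigma s) -> gap_ge.
Proof.
move=> oplus; apply: (gap_ge_necessary oplus) => [phi E|phi E PE].
  exact: Add_gen.
(* This property passes to sums by block matrices and to summands by compression with the inclusion
   and projection. *)
have [A [B [u [v [p [q [UA VB e]]]]]]] : exists A B (u : hom A E) (v : hom B E)
    (p : hom E A) (q : hom E B),
    [/\ level_ge X H 1 A, level_lt X H 1 B & u ∘ p + v ∘ q = idm E].
  have [Z0 Z00] := tr_zero (triP D).
  move: E PE; apply: add_closure_ind_sub => [E /induced_genP[l El]|E E0|E E' S|E E' S].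
  - have [l1|l0] := leP 1 l.
      exists E, Z0, (idm E), 0, (idm E), 0.
      rewrite comp0r addr0 comp_idl; split=> //; last exact: Ext_zero.
      exact: level_ge_gen l1 (lslice_level El).
    exists Z0, E, 0, (idm E), 0, (idm E).
    rewrite comp0r add0r comp_idl; split=> //; first exact: Ext_zero.
    exact: level_lt_gen l0 (lslice_level El).
  - exists E, E, 0, 0, 0, 0; rewrite !comp0r addr0.
    by split=> //; exact: Ext_zero.
  - case=> i [i' [p [p' [pi pi' p'i pi'0 e]]]].
    move=> [A [B [u [v [a [b [UA VB e1]]]]]]] [A' [B' [u' [v' [a' [b' [UA' VB' e2]]]]]]].
    have [A2 A2P] := tr_dsum (triP D) A A'; have [B2 B2P] := tr_dsum (triP D) B B'.
    have UA2 : level_ge X H 1 A2 by exact: Ext_ext (is_ext_dsum A2P) UA UA'.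
    have VB2 : level_lt X H 1 B2 by exact: Ext_ext (is_ext_dsum B2P) VB VB'.
    have [j [j' [t [t' [tj tj' t'j tj'0 _]]]]] := A2P.
    have [w [w' [x [x' [xw xw' x'w xw'0 _]]]]] := B2P.
    have glue Y Y' Y2 (f : hom Y E) (f' : hom Y' E') (g : hom E Y) (g' : hom E' Y')
        (l : hom Y Y2) (l' : hom Y' Y2) (m : hom Y2 Y) (m' : hom Y2 Y') :
        m ∘ l = idm Y -> m' ∘ l' = idm Y' -> m' ∘ l = 0 -> m ∘ l' = 0 ->
        (i ∘ f ∘ m + i' ∘ f' ∘ m') ∘ (l ∘ g ∘ p + l' ∘ g' ∘ p')
        = i ∘ (f ∘ g) ∘ p + i' ∘ (f' ∘ g') ∘ p'.
      move=> ml ml' m'l ml'0; rewrite compDr !compDl.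
      rewrite !comp_assoc -!(comp_assoc _ m) -!(comp_assoc _ m').
      by rewrite ml ml' m'l ml'0 !comp_idr !comp0r !comp0l addr0 add0r.
    exists A2, B2, (i ∘ u ∘ t + i' ∘ u' ∘ t'), (i ∘ v ∘ x + i' ∘ v' ∘ x').
    exists (j ∘ a ∘ p + j' ∘ a' ∘ p'), (w ∘ b ∘ p + w' ∘ b' ∘ p'); split=> //.
    rewrite !glue // addrACA -!compDl -!compDr e1 e2 !comp_idr.
    exact: e.
  - case=> i [i' [p [p' [pi _ _ _ _]]]] [A [B [u [v [a [b [UA VB e]]]]]]].
    exists A, B, (p ∘ u), (p ∘ v), (a ∘ i), (b ∘ i); split=> //.
    rewrite !comp_assoc -!(comp_assoc p) -compDr -compDl e comp_idl; exact: pi.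
have [C [F [CEF lC lF]]] := level_trunc X_exact hH 1 E.
apply: (so_retract_split (level_semiorthogonal X_exact hH 1) UA VB e).
by exists C, F.
Qed.

Lemma zero_slice_cls phi (B : heart hH) : P phi B -> cls B = 0 -> is_zero B.
Proof.
move=> /charge_cls[m _ [e mz]] B0; apply: mz.
move: e; rewrite B0 (zmod_morph0 (stab_charge hsigma)) => /esym/eqP.
rewrite mulf_eq0 (negbTE (expipi_neq0 _)) orbF => /eqP e.
by have [] := e.
Qed.

(** [B l] is the direct sum of the generators of level [l] that build [E]. It shares class and phase
    with the graded piece, and vanishes only if each of these generators does, whence the last
    clause. *)
Lemma star_pieces phi E : ext_closure (induced_gen sigma s phi) E ->
  exists B : int -> heart hH, [/\ forall l, P (phi - l%:~R * r) (B l),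
    forall l, coef X_exact hH l (cls E) = cls (B l)
  & (forall l, l != 0 -> is_zero (B l)) -> H E].
Proof.
have [Z0 Z00] := tr_zero (triP (heart hH)); have cM := coef_morph X_exact hH.
move: E; apply: ext_closure_ind_sub => [E /induced_genP[l [C PC CE]]|E E0|A E A'].
- exists (fun m => if m == l then C else Z0); split=> [m|m|CZ].
  + by case: eqP => [->//|_]; exact: (slice_zero hsigma).
  + rewrite -(cls_iso CE) -(qact_incl_cls X_exact) coef_qact.
    by case: eqP => // _; rewrite cls_zero.
  + have [l0|l0] := eqVneq l 0.
      by apply: heart_iso hH _ _ CE _; rewrite l0; exact: svalP C.
    apply: (heart_zero hH); apply: iso_zero CE _; apply/xpow_zero.
    by have := CZ l l0; rewrite eqxx.
- exists (fun _ => Z0); split=> [l|l|_]; first exact: (slice_zero hsigma).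
    by rewrite (cls_zero E0) (cls_zero Z00) (zmod_morph0 (cM l)).
  exact: (heart_zero hH E0).
move=> AEA' [B [PB cB HB]] [B' [PB' cB' HB']].
have /choice[C CP] l : exists C, is_dsum (B l) (B' l) C.
  exact: tr_dsum (triP (heart hH)) (B l) (B' l).
exists C; split=> [l|l|CZ].
- exact: (slice_dsum hsigma (CP l)).
- by rewrite (cls_ext AEA') (zmod_morphD (cM l)) cB cB' (cls_dsum (CP l)).
apply: (heart_ext hH AEA'); [apply: HB|apply: HB'] => l /CZ.
  exact: is_dsum_zerol (CP l).
exact: is_dsum_zerol (is_dsum_sym (CP l)).
Qed.

Lemma qpolyE n (a : 'I_n.+1 -> K0 (heart hH)) :
  qpoly X incl a = \sum_(i < n.+1) qact X i (incl (a i)).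
Proof. by []. Qed.

Lemma coef_qpoly n (a : 'I_n.+1 -> K0 (heart hH)) (i : 'I_n.+1) :
  coef X_exact hH i (qpoly X incl a) = a i.
Proof.
rewrite qpolyE (zmod_morph_sum (coef_morph X_exact hH i)) (bigD1 i) //=.
rewrite coef_qact eqxx big1 ?addr0// => j ji.
by rewrite coef_qact; case: eqP => // -[/val_inj ij]; rewrite ij eqxx in ji.
Qed.

Lemma coef_qpoly_out n (a : 'I_n.+1 -> K0 (heart hH)) (i : nat) : (n < i)%N ->
  coef X_exact hH i (qpoly X incl a) = 0.
Proof.
move=> ni; rewrite qpolyE (zmod_morph_sum (coef_morph X_exact hH i)).
apply: big1 => j _; rewrite coef_qact; case: eqP => // -[ij].
by have := ltn_ord j; rewrite -ij ltnS leqNgt ni.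
Qed.

(** The norm bound of [q_support] ranges over all polynomial expressions of a class; these differ
    only by trailing zero coefficients. *)
Lemma sum_qpoly (nrm : K0 (heart hH) -> R) (w : nat -> R) (m n : nat)
    (a : 'I_m.+1 -> K0 (heart hH)) (b : 'I_n.+1 -> K0 (heart hH)) :
  nrm 0 = 0 -> qpoly X incl a = qpoly X incl b ->
  \sum_(i < m.+1) w i * nrm (a i) = \sum_(i < n.+1) w i * nrm (b i).
Proof.
move=> nrm0 ab; pose F (i : nat) := w i * nrm (coef X_exact hH i (qpoly X incl a)).
have Fa : \sum_(i < m.+1) w i * nrm (a i) = \sum_(i < m.+1) F i.
  by apply: eq_bigr => i _; rewrite /F coef_qpoly.
have Fb : \sum_(i < n.+1) w i * nrm (b i) = \sum_(i < n.+1) F i.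
  by apply: eq_bigr => i _; rewrite /F ab coef_qpoly.
rewrite Fa Fb (big_ord_pad (leq_maxl m.+1 n.+1)) => [|i mi]; last first.
  by rewrite /F coef_qpoly_out// nrm0 mulr0.
rewrite [RHS](big_ord_pad (leq_maxr m.+1 n.+1)) // => i ni.
by rewrite /F ab coef_qpoly_out// nrm0 mulr0.
Qed.

(** * The [q]-stability and [q]-support properties *)

Section QStability.
Variable tau : stabData R D.
Hypothesis htau : is_stability tau.
Hypothesis tau_charge : charge tau = Z.
Hypothesis tau_gen : forall phi E, induced_gen sigma s phi E -> slice tau phi E.
Hypothesis tau_star : forall phi E,
  slice tau phi E -> ext_closure (induced_gen sigma s phi) E.

Lemma induced_qstability :
  (forall phi, ess_im X (slice tau phi) = slice tau (phi + r)) ->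
  is_qstability X tau s.
Proof.
move=> tauX; split=> // a; rewrite tau_charge.
have ZM := induced_charge_morph; have qM := qact_morph X_exact.
apply: (@K0_morph_ext k D X X_exact H hH _ (fun a => Z (qact X 1 a))
  (fun a => expipi s * Z a)) => [x y|x y|l x].
- by rewrite qM ZM.
- by rewrite ZM mulrBr.
by rewrite -qactD // !induced_charge_qact mulrzDr mulr1z expipiD mulrA.
Qed.

(** The phases are those for which all [X^i B_i] have phase [phi]. Zero objects are allowed as
    coefficients, since a semistable object may skip levels. *)
Let hss : set (K0 D) := [set x | exists phi n (B : 'I_n.+1 -> heart hH),
  [/\ forall i : 'I_n.+1, P (phi - (i : nat)%:R * r) (B i), exists i, ~ is_zero (B i)
    & x = qpoly X incl (fun i => cls (B i))]].

Let ss_hss : ss tau = \bigcup_(l in [set: int]) (qact X l @` hss).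
Proof.
apply/seteqP; split=> x.
  move=> [E [E0 [phi PE]] <-].
  have [B [PB cB _]] := star_pieces (tau_star PE).
  have [N /(_ N (leqnn N))[eE _]] := K0_expand X_exact hH (cls E).
  pose C (i : 'I_N.*2.+1) : heart hH := B (i%:Z - N%:Z).
  have eE' : cls E = qact X (- N%:Z) (qpoly X incl (fun i => cls (C i))).
    rewrite qpolyE (zmod_morph_sum (qact_morph X_exact _)) {1}eE big_zrange.
    by apply: eq_bigr => i _; rewrite -qactD // cB [- N%:Z + _]addrC.
  (* The levels lie between [-N] and [N]; factoring out [q^-N] makes the exponents nonnegative and
     moves the phase by [N * r]. *)
  exists (- N%:Z) => //; exists (qpoly X incl (fun i => cls (C i))) => //.
  exists (phi + N%:R * r), N.*2, C; split=> [i||//].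
    rewrite (_ : _ - _ = phi - (i%:Z - N%:Z)%:~R * r); first exact: PB.
    by rewrite intrB -!pmulrn; ring.
  (* If all coefficients were zero objects, the charge of [E] would vanish, against its positive
     mass. *)
  apply: contrapT => /forallNP C0.
  have [m m0] := stab_phase htau PE E0.
  rewrite tau_charge eE' qpolyE big1 => [|i _]; last first.
    rewrite (cls_zero (contrapT (C0 i))) (zmod_morph0 (@heart_incl_morph k D X H hH)).
    exact: (zmod_morph0 (qact_morph X_exact _)).
  rewrite (zmod_morph0 (qact_morph X_exact _)) (zmod_morph0 induced_charge_morph).
  move/esym/eqP; rewrite mulf_eq0 (negbTE (expipi_neq0 _)) orbF => /eqP[m0'].
  by rewrite m0' ltxx in m0.
move=> [l _ [_ [phi [n [B [PB [i0 Bi0] ->]]]] <-]].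
(* The class is realized by a direct sum of the pieces, which stays in the slice for both
   constructions. *)
suff [E [PE eE E0]] : exists E, [/\ slice tau (phi + l%:~R * r) E,
    cls E = \sum_(i <- enum 'I_n.+1) cls (xpow X (l + i%:Z) (heart_ob (B i)))
  & is_zero E -> forall i, i \in enum 'I_n.+1 -> is_zero (B i)].
  exists E; first split; last 1 [idtac] || idtac.
  - by move=> /E0/(_ i0); rewrite mem_enum => /(_ isT).
  - by exists (phi + l%:~R * r).
  rewrite eE big_enum /= qpolyE (zmod_morph_sum (qact_morph X_exact _)).
  by apply: eq_bigr => i _; rewrite -qactD // (qact_incl_cls X_exact).
elim: (enum _) => [|i t [E [PE eE E0]]].
  have [Z0 Z00] := tr_zero (triP D).
  by exists Z0; split; [exact: slice_zero | rewrite big_nil cls_zero |].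
set F := xpow X (l + i%:Z) (heart_ob (B i)).
have [S FES] := tr_dsum (triP D) F E.
have PF : slice tau (phi + l%:~R * r) F.
  apply/tau_gen/induced_genP; exists (l + i%:Z); exists (B i); last exact: iso_refl.
  by rewrite intrD mulrDl opprD addrA addrK; exact: PB.
exists S; split; first exact: slice_dsum FES PF PE.
  by rewrite big_cons (cls_dsum FES) eE.
move=> S0 j; rewrite inE => /orP[/eqP ->|].
  by apply/(xpow_zero X (l + i%:Z))/(is_dsum_zerol FES).
by apply: E0; exact: is_dsum_zerol (is_dsum_sym FES) S0.
Qed.

Let hss_norm : support_property sigma -> exists2 nrm : K0 (heart hH) -> R,
  lattice_norm nrm & exists2 c : R, 0 < c
  & forall n (a : 'I_n.+1 -> K0 (heart hH)), hss (qpoly X incl a) ->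
     \sum_(i < n.+1) normc (expipi (s *+ i)) * nrm (a i)
     < c * normc (Z (qpoly X incl a)).
Proof.
move=> [nrm nrmL [c c0 nrm_lt]]; exists nrm => //; exists c => // n a.
move=> [phi [n' [B [PB [i0 Bi0] ea]]]]; have nrm0 := lattice_norm0 nrmL.
rewrite (sum_qpoly (fun i => normc (expipi (s *+ i))) nrm0 ea) ea {n a ea}.
pose w (i : 'I_n'.+1) := normc (expipi (s *+ i)).
have w0 i : 0 < w i by exact: normc_expipi_gt0.
(* [m i] is the mass of [B i]. A zero object satisfies only the weak bound, so the strict one is
   kept for nonzero pieces. *)
have /fin_all_exists[m mP] (i : 'I_n'.+1) : exists m : R,
    [/\ 0 <= m, expipi (s *+ i) * charge sigma (cls (B i))
      = (w i * m)%:C%C * expipi phi%:C%C, nrm (cls (B i)) <= c * m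
      & ~ is_zero (B i) -> nrm (cls (B i)) < c * m].
  have [m m0 [e1 e2 mz]] := charge_level (PB i : P (phi - (i : nat)%:Z%:~R * r) (B i)).
  have lt_m : ~ is_zero (B i) -> nrm (cls (B i)) < c * m.
    move=> B0; have -> : m = normc (charge sigma (cls (B i))).
      by rewrite e1 normc_ray.
    apply: nrm_lt; exists (B i) => //; split=> //.
    by exists (phi - (i : nat)%:R * r); exact: PB.
  exists m; split=> //.
  have [B0|/lt_m/ltW//] := pselect (is_zero (B i)).
  by rewrite (cls_zero B0) nrm0 mulr_ge0// ltW.
have -> : Z (qpoly X incl (fun i => cls (B i)))
    = (\sum_i w i * m i)%:C%C * expipi phi%:C%C.
  rewrite qpolyE (zmod_morph_sum induced_charge_morph) rmorph_sum mulr_suml.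
  apply: eq_bigr => i _; rewrite induced_charge_qact.
  by have [_ <- _ _] := mP i.
rewrite normc_ray; last first.
  by apply: sumr_ge0 => i _; apply: mulr_ge0; [exact: ltW | have [] := mP i].
(* Strictness of the total comes from the nonzero piece [B i0]. *)
rewrite mulr_sumr (bigD1 i0) //= [X in _ < X](bigD1 i0) //=.
apply: ltr_leD.
  have [_ _ _ /(_ Bi0)] := mP i0.
  by rewrite -/(w i0) [c * (_ * _)]mulrCA (ltr_pM2l (w0 i0)).
apply: ler_sum => i _; have [_ _ le_m _] := mP i.
by rewrite -/(w i) [c * (_ * _)]mulrCA (ler_pM2l (w0 i)).
Qed.

(** A class from the lattice has no coefficient outside level zero, and a semistable piece of class
    zero has mass zero, hence vanishes. *)
Lemma semistable_heart E : semistable tau E -> range incl (cls E) -> H E.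
Proof.
move=> [E0 [phi /tau_star/star_pieces[B [PB cB HB]]]] [a _ ea].
apply: HB => l l0; apply: zero_slice_cls (PB l) _.
rewrite -cB -ea -[incl a](qact0 X_exact) coef_qact.
by rewrite (negbTE l0).
Qed.

Lemma induced_qsupport n : K0_free X n -> support_property sigma ->
  q_support X tau s n incl.
Proof.
move=> hfree hsupp; split.
- case: hsupp => nrm [m [b [N [bP _ _]]]] _.
  exact: (heart_Zbasis X_exact bP hfree).
- by split; [exact: heart_incl_morph | exact: (heart_incl_inj X_exact)].
- exact: (heart_tensor_bij X_exact hH).
- exists hss; split.
  + by move=> x [phi [m [B [_ _ ->]]]]; exists m, (fun i => cls (B i)).
  + exact: ss_hss.
  + by rewrite tau_charge; exact: hss_norm.
move=> E ssE rE; have HE := semistable_heart ssE rE.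
(* Both objects lie in the heart. Levels at distance at least two are orthogonal both ways,
   downwards by the baric axiom and upwards by Serre duality, so [N0 = 1] serves for every [E]. *)
exists 1%N => F [phi [PF F0 _]] rF l l1.
have HF : H F by apply: semistable_heart rF; split=> //; exists phi.
have far A B : H A -> H B -> orth A (xpow X l B).
  move=> /(level0 hH) A0 HB; have Bl := level_xpow X l HB.
  have [l_lt|l_ge] := ltP l 0; first exact: level_orth hH _ _ _ _ l_lt A0 Bl.
  by apply: level_orth_far A0 Bl; lia.
by split; exact: far.
Qed.

End QStability.

End Induced.

Theorem theorem5p9 (R : realType) (k : closedFieldType) (D : triCategory k)
    (X : autoequiv D) (hX : exact_functor X) (hCY : calabi_yau X)
    (n : nat) (hfree : K0_free X n)
    (T : set D) (hT : baric_heart X T)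
    (sigma : stabData R (heart hT))
    (hsigma : is_stability sigma) (hsupp : support_property sigma)
    (s : R[i]) :
  [/\ is_stability (sigma_oplus sigma s) <->
        (forall phi1 phi2 : R, complex.Re s - 1 <= phi2 - phi1 ->
           hom_vanish (slice sigma phi1) (slice sigma phi2)),
      is_stability (sigma_star sigma s) <->
        (gldim sigma <= (complex.Re s - 1)%:E)%E,
      is_stability (sigma_oplus sigma s) ->
        is_qstability X (sigma_oplus sigma s) s /\
        q_support X (sigma_oplus sigma s) s n (@heart_incl k D X T hT)
    & is_stability (sigma_star sigma s) ->
        is_qstability X (sigma_star sigma s) s /\
        q_support X (sigma_star sigma s) s n (@heart_incl k D X T hT)].
Proof.
have oplusP : is_stability (sigma_oplus sigma s) <-> gap_ge sigma s.
  by split; [exact: oplus_gap | exact: oplus_stability].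
have starP : is_stability (sigma_star sigma s) <-> gap_gt sigma s.
  by split; [exact: star_gap | exact: star_stability].
split=> [||oplus|star].
- exact: oplusP.
- by rewrite gldim_gap.
- have gen phi E : induced_gen sigma s phi E -> slice (sigma_oplus sigma s) phi E.
    exact: Add_gen.
  (* The support estimates concern extension closures; the gap condition places the additive slices
     inside them. *)
  have sub := oplus_sub_star hX hCY hsigma (gap_ge_gt (oplusP.1 oplus)).
  split; last exact: (induced_qsupport hX hCY hsigma oplus erefl gen sub hfree hsupp).
  apply: (induced_qstability hX hsigma oplus erefl) => phi.
  exact/add_closure_ess_im/induced_gen_X.
- have gen phi E : induced_gen sigma s phi E -> slice (sigma_star sigma s) phi E.
    exact: Ext_gen.
  have sub phi E : slice (sigma_star sigma s) phi E ->
      ext_closure (induced_gen sigma s phi) E by [].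
  split; last exact: (induced_qsupport hX hCY hsigma star erefl gen sub hfree hsupp).
  apply: (induced_qstability hX hsigma star erefl) => phi.
  exact/(ext_closure_ess_im hX)/induced_gen_X.
Qed.
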